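(* Let $k$ be a positive integer and let $G$ be a $2$-connected graph containing a non-separating induced odd cycle. If $\delta(G)\ge k+1$, then $G$ contains $k$ cycles which have consecutive lengths or satisfy the length condition.
   Context: All graphs are finite and simple; $\delta(G)$ is the minimum degree. A cycle $C$ in a connected graph $G$ is non-separating if $G-V(C)$ is connected. A sequence of cycles $H_1,\dots,H_k$ has consecutive lengths if $|E(H_1)|\ge 2$ and $|E(H_{i+1})|-|E(H_i)|=1$ for $1\le i\le k-1$; it satisfies the length condition if $|E(H_1)|\ge 2$ and $|E(H_{i+1})|-|E(H_i)|=2$ for $1\le i\le k-1$. *)

(* Defs.v *)
From mathcomp Require Import all_boot.

Set Implicit Arguments.
Unset Strict Implicit.
Unset Printing Implicit Defensive.

(* A finite simple graph is a symmetric irreflexive relation e on a finType T;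
   these two properties are hypotheses of the theorem, not of the definitions. *)
Section Graphs.

Variables (T : finType) (e : rel T).

Definition degree (x : T) : nat := #|[set y | e x y]|.

(* Degrees are smaller than #|T|, so the default value of the iterated minimum
   is harmless as soon as the graph has a vertex. *)
Definition min_degree : nat := \big[minn/#|T|]_(x : T) degree x.

(* G[A] is connected; the empty graph counts as connected. *)
Definition connected_on (A : {set T}) : Prop :=
  {in A &, forall x y, connect [rel u v in A | e u v] x y}.

(* G - X is connected for every set X of fewer than k vertices. *)
Definition k_connected (k : nat) : Prop :=
  k < #|T| /\ forall X : {set T}, #|X| < k -> connected_on (~: X).

(* A cycle is given by the cyclic list of its distinct vertices, at least three
   of them, so that its number of edges |E(C)| is the size of the list. *)
Definition is_cycle (C : seq T) : bool := (2 < size C) && ucycleb e C.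

Definition num_edges (C : seq T) : nat := size C.

(* Every edge of G between vertices of C is an edge of C. *)
Definition induced_cycle (C : seq T) : Prop :=
  is_cycle C /\
  {in C &, forall x y, e x y -> y = next C x \/ x = next C y}.

Definition non_separating (C : seq T) : Prop :=
  connected_on (~: [set x in C]).

(* Hs = [:: H_1; ...; H_k] with |E(H_1)| >= 2 and
   |E(H_(i+1))| - |E(H_i)| = d for 1 <= i <= k - 1. *)
Definition lengths_step (d : nat) (Hs : seq (seq T)) : Prop :=
  2 <= num_edges (head [::] Hs) /\
  forall i, i.+1 < size Hs ->
    num_edges (nth [::] Hs i.+1) = num_edges (nth [::] Hs i) + d.

Definition consecutive_lengths (Hs : seq (seq T)) : Prop := lengths_step 1 Hs.

Definition length_condition (Hs : seq (seq T)) : Prop := lengths_step 2 Hs.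

End Graphs.

(* Main.v *)
(* Fix an edge xy. It suffices to find, in G - {x, y}, k paths from neighbours
   of x to one neighbour of y whose lengths form an arithmetic progression of
   difference 1 or 2. This is proved by induction on the number of vertices in a
   weighted form: the graph lives on V, the set A consists of the neighbours of
   a root outside V, and b v counts the edges from v to a contracted target
   outside V. If every v satisfies deg v + [v in A] + b v > k and the graph is
   "2-connected towards root and target", then some u with b u > 0 is the end of
   n paths starting in A, with lengths in progression, where n + b u > k.
   Progressions of m and p terms with differences 1 or 2 add up to one of
   m + p - 1 terms, so a loss of degree at a vertex is compensated by
   progressions of lengths inside the part of the graph that was removed. In the
   induction step this part is built from one of three cores next to the root:
   a maximal clique of A; two vertices of A with a maximal clique (with an edge)
   among their common neighbours; or, if neither has an edge, a maximal set S
   with more than |S| common neighbours in A. *)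

Require Import Defs.
From mathcomp Require Import all_boot zify.

Set Implicit Arguments.
Unset Strict Implicit.
Unset Printing Implicit Defensive.

(** * Arithmetic progressions *)

(** Contracting a set into the target costs no degree, since [b] counts multiplicities; contracting
    a set into the root does, since membership in [A] records only one edge. The loss at a vertex
    must be paid by lengths valid at every landing vertex of the contracted set, and the maximal
    choice of the core bounds it: an outer vertex that lost too much could be added to the core. A
    second obstacle is that contraction may destroy the cut condition; the part cut off is then
    treated with root and target exchanged, which is why tails from the root set are tracked as
    well. Finally, the core may contain all the weight. For this case instances are normalised so
    that a vertex of maximal weight [j] has a neighbour of weight [j], which puts such a vertex at a
    useful place in the core: it is split off as a new target, or a clique containing it is
    contracted into the target, or the lengths ending at it already suffice. *)

Definition ap (P : nat -> Prop) (n : nat) : Prop :=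
  exists a d, (d = 1 \/ d = 2) /\ forall i, i < n -> P (a + d * i).

Lemma ap_leq P m n : m <= n -> ap P n -> ap P m.
Proof.
move=> mn [a [d [dP aP]]]; exists a, d; split=> // i im.
by apply: aP; apply: leq_trans mn.
Qed.

Lemma ap_imp (P Q : nat -> Prop) n : (forall i, P i -> Q i) -> ap P n -> ap Q n.
Proof. by move=> PQ [a [d [dP aP]]]; exists a, d; split=> // i /aP/PQ. Qed.

Lemma ap_add (P Q : nat -> Prop) c n :
  (forall i, P i -> Q (i + c)) -> ap P n -> ap Q n.
Proof.
move=> PQ [a [d [dP aP]]]; exists (a + c), d; split=> // i /aP/PQ.
by rewrite addnAC.
Qed.

Lemma ap_range (P : nat -> Prop) a n :
  (forall i, a <= i < a + n -> P i) -> ap P n.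
Proof. by move=> aP; exists a, 1; split=> [|i ilt]; [left | apply: aP; lia]. Qed.

Lemma ap1 (P : nat -> Prop) a : P a -> ap P 1.
Proof. by move=> Pa; apply: (@ap_range P a) => i ai; have -> : i = a by lia. Qed.

(** For equal differences, run through one progression and then the other. For differences 1 and 2
    the sums fill an interval as soon as the progression of difference 1 has two terms, because its
    unit steps bridge the gaps; with one term the sum is a translate of the other progression. *)
Lemma ap_sum (P Q : nat -> Prop) m p :
    0 < m -> 0 < p -> ap P m -> ap Q p ->
  ap (fun n => exists a b, [/\ P a, Q b & n = a + b]) (m + p).-1.
Proof.
move=> m0 p0 [a [d [dP aP]]] [b [f [fP bP]]].
have same d' : (forall i, i < m -> P (a + d' * i)) ->
    (forall i, i < p -> Q (b + d' * i)) ->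
    forall i, i < (m + p).-1 ->
    exists a' b', [/\ P a', Q b' & (a + b) + d' * i = a' + b'].
  move=> aP' bP' i ilt; exists (a + d' * minn i m.-1), (b + d' * (i - m.-1)).
  split; [apply: aP'; lia | apply: bP'; lia | ].
  have -> : i = minn i m.-1 + (i - m.-1) by lia.
  rewrite mulnDr; lia.
case: dP fP => dP [] fP; subst d f.
- by exists (a + b), 1; split; [left | apply: same].
- have [m1|m1] := leqP m 1.
    exists (a + b), 2; split; first by right.
    move=> i ilt; exists a, (b + 2 * i); split; [|apply: bP; lia|lia].
    by have := aP 0; rewrite muln0 addn0; apply; lia.
  exists (a + b), 1; split; first by left.
  move=> i ilt.
  (* As many steps of length 2 as possible: the remainder [i - 2 * i2] is 0 or 1, or at most [m - p]
     once the second progression is exhausted. *)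
  pose i2 := minn i./2 p.-1; have := odd_double_half i => iE.
  exists (a + 1 * (i - 2 * i2)), (b + 2 * i2).
  by split; [apply: aP; lia | apply: bP; lia | lia].
- have [p1|p1] := leqP p 1.
    exists (a + b), 2; split; first by right.
    move=> i ilt; exists (a + 2 * i), b; split; [apply: aP; lia| |lia].
    by have := bP 0; rewrite muln0 addn0; apply; lia.
  exists (a + b), 1; split; first by left.
  move=> i ilt.
  pose i2 := minn i./2 m.-1; have := odd_double_half i => iE.
  exists (a + 2 * i2), (b + 1 * (i - 2 * i2)).
  by split; [apply: aP; lia | apply: bP; lia | lia].
by exists (a + b), 2; split; [right | apply: same].
Qed.

(** * Paths, boundaries and components *)

Section Graph.

Variables (T : finType) (e : rel T).
Hypothesis e_sym : symmetric e.
Hypothesis e_irr : irreflexive e.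

Implicit Types (V W A D K L Z S Q : {set T}) (u v w x y z : T) (b g : T -> nat).

Definition spath W x y (n : nat) : Prop :=
  exists p, [/\ path e x p, last x p = y, uniq (x :: p),
                {subset x :: p <= W} & size p = n].

Lemma spath_refl W x : x \in W -> spath W x x 0.
Proof. by move=> xW; exists [::]; split=> // z; rewrite inE => /eqP->. Qed.

Lemma spath_sub W V x y n : W \subset V -> spath W x y n -> spath V x y n.
Proof.
by move=> /subsetP WV [p [? ? ? pW ?]]; exists p; split=> // z /pW/WV.
Qed.

Lemma spath_mem W x y n : spath W x y n -> x \in W /\ y \in W.
Proof.
move=> [p [_ <- _ pW _]]; split; apply: pW; [exact: mem_head | exact: mem_last].
Qed.

Lemma spath_rev W x y n : spath W x y n -> spath W y x n.
Proof.
move=> [p [ep <- up pW sp]]; exists (rev (belast x p)).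
have E : last x p :: rev (belast x p) = rev (x :: p).
  by rewrite [x :: p]lastI rev_rcons.
split.
- by rewrite rev_path -(eq_path (e := e)) // => a b; rewrite e_sym.
- by case: p {ep up pW sp E} => //= y0 p; rewrite rev_cons last_rcons.
- by rewrite E rev_uniq.
- by move=> z; rewrite E mem_rev => /pW.
- by rewrite size_rev size_belast.
Qed.

Lemma spath_join W V x y x' z n m :
    spath W x y n -> spath V x' z m -> e y x' -> [disjoint W & V] ->
  spath (W :|: V) x z (n + m).+1.
Proof.
move=> [p [ep lp up pW <-]] [q [eq lq uq qV <-]] eyx WV.
exists (p ++ x' :: q); split.
- by rewrite cat_path ep /= lp eyx.
- by rewrite last_cat.
- rewrite -cat_cons cat_uniq up uq andbT.
  apply/hasPn => t /qV tV; apply/negP => /pW tW.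
  by rewrite (disjointFr WV tW) in tV.
- move=> t; rewrite -cat_cons mem_cat in_setU => /orP[/pW->//|/qV->].
  by rewrite orbT.
- by rewrite size_cat /= addnS.
Qed.

Lemma spath_cat W V x y z n m :
    spath W x y n -> spath V y z m -> W :&: V \subset [set y] ->
  spath (W :|: V) x z (n + m).
Proof.
move=> [p [ep lp up pW <-]] [q [eq lq uq qV <-]] /subsetP WV.
have yq : y \notin q by move: uq; rewrite cons_uniq => /andP[].
exists (p ++ q); split.
- by rewrite cat_path ep lp.
- by rewrite last_cat lp.
- move: uq; rewrite -cat_cons cat_uniq up cons_uniq => /andP[_ ->]; rewrite andbT.
  apply/hasPn => t tq; apply/negP => /pW tW.
  have : t \in W :&: V by rewrite inE tW qV // inE tq orbT.
  by move/WV; rewrite inE => /eqP ty; rewrite -ty tq in yq.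
- move=> t; rewrite -cat_cons mem_cat in_setU => /orP[/pW->//|tq].
  by rewrite qV ?orbT // inE tq orbT.
- by rewrite size_cat.
Qed.

Lemma spath_cons W x y z n :
    spath W x y n -> e z x -> z \notin W -> spath (z |: W) z y n.+1.
Proof.
move=> pxy ezx zW; apply: (@spath_join [set z] W z z x y 0) => //.
  by apply: spath_refl; rewrite inE.
by rewrite disjoints1.
Qed.

Lemma spath_rcons W x y z n :
    spath W x y n -> e y z -> z \notin W -> spath (z |: W) x z n.+1.
Proof.
move=> /spath_rev pxy eyz zW; apply: spath_rev; apply: spath_cons pxy _ _ => //.
by rewrite e_sym.
Qed.

Definition rpath W A y n : Prop := exists2 x, x \in A & spath W x y n.

Lemma rpath_sub W V A y n : W \subset V -> rpath W A y n -> rpath V A y n.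
Proof. by move=> WV [x xA xy]; exists x => //; apply: spath_sub xy. Qed.

Lemma rpath_join W V A y x z n m :
    rpath W A y n -> spath V x z m -> e y x -> [disjoint W & V] ->
  rpath (W :|: V) A z (n + m).+1.
Proof. by move=> [x0 x0A px] pz eyx WV; exists x0 => //; apply: spath_join eyx _. Qed.

Definition nbr v : {set T} := [set w | e v w].

Lemma in_nbr v w : (w \in nbr v) = e v w.
Proof. by rewrite inE. Qed.

Lemma in_nbrI v w Z : (w \in nbr v :&: Z) = e v w && (w \in Z).
Proof. by rewrite in_setI in_nbr. Qed.

Definition nb W D : {set T} := [set w in W | (w \notin D) && [exists v in D, e v w]].

Lemma nbP W D w :
  reflect [/\ w \in W, w \notin D & exists2 v, v \in D & e v w] (w \in nb W D).
Proof.
rewrite !inE; apply: (iffP and3P) => [[wW wD /existsP[v /andP[vD evw]]]|].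
  by split=> //; exists v.
by move=> [wW wD [v vD evw]]; split=> //; apply/existsP; exists v; rewrite vD.
Qed.

(** Phrased through boundaries so that it applies directly to the parts [D] of the cut conditions
    below. *)
Definition conn W : Prop :=
  forall D, D \subset W -> D != set0 -> nb W D = set0 -> D = W.

Lemma conn_nb W D : conn W -> D \subset W -> D != set0 -> D != W ->
  nb W D != set0.
Proof. by move=> cW DW D0; apply: contraNneq => /(cW _ DW D0)->. Qed.

Definition component W x : {set T} :=
  [set y | connect (fun u v => [&& u \in W, v \in W & e u v]) x y].

Lemma comp_id W x : x \in component W x.
Proof. by rewrite inE connect0. Qed.

Lemma comp_sub W x : x \in W -> component W x \subset W.
Proof.
move=> xW; apply/subsetP => y; rewrite inE => /connectP[p pp ->].
by elim: p x xW pp => //= z p IH x xW /andP[/and3P[_ zW _]]; apply: IH.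
Qed.

Lemma comp_step W x y z :
  x \in W -> y \in component W x -> z \in W -> e y z -> z \in component W x.
Proof.
move=> xW yC zW eyz; have yW := subsetP (comp_sub xW) _ yC.
move: yC; rewrite !inE => /connect_trans; apply; apply: connect1.
by rewrite yW zW.
Qed.

Lemma nb_comp W x : x \in W -> nb W (component W x) = set0.
Proof.
move=> xW; apply/eqP; rewrite -subset0; apply/subsetP => w.
move=> /nbP[wW /negP wC [v vC evw]]; case: wC; exact: comp_step evw.
Qed.

Lemma comp_conn W x : x \in W -> conn (component W x).
Proof.
move=> xW D DC /set0Pn[y yD] nD; apply/eqP; rewrite eqEsubset DC.
set r := (fun u v => [&& u \in W, v \in W & e u v]).
have rsym : symmetric r by move=> u v; rewrite /r e_sym andbCA.
apply/subsetP => z zC.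
have : connect r y z.
  apply: (@connect_trans _ _ x); last by move: zC; rewrite inE.
  rewrite (sym_connect_sym rsym); move: (subsetP DC _ yD); by rewrite inE.
move/connectP => [p pp ->]; elim: p y yD pp => //= u p IH y yD /andP[yu pp].
apply: IH pp; case/and3P: yu => _ uW eyu; apply/negPn/negP => uD.
have : u \in nb (component W x) D.
  apply/nbP; split=> //; last by exists y.
  exact: comp_step (subsetP DC _ yD) uW eyu.
by rewrite nD inE.
Qed.

Lemma conn_spath W x y : conn W -> x \in W -> y \in W -> exists n, spath W x y n.
Proof.
move=> cW xW yW.
have CW : component W x = W.
  apply: cW; [exact: comp_sub | | exact: nb_comp].
  by apply/set0Pn; exists x; apply: comp_id.
move: yW; rewrite -{1}CW inE => /connectP[p pp ->].
case/shortenP: pp => q qp uq _; exists (size q), q; split=> //.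
  by apply: sub_path qp => u v /and3P[].
move=> z; rewrite inE => /orP[/eqP->//|zq].
elim: q x {p xW cW CW uq} qp zq => //= u q IH x /andP[/and3P[_ uW _] qp].
by rewrite inE => /orP[/eqP->//|]; apply: IH qp.
Qed.

(** * Paths of prescribed length in cliques and bicliques *)

Definition clique K : Prop := {in K &, forall u v, u != v -> e u v}.

Lemma clique_path K w n : clique K -> w \in K -> n < #|K| ->
  exists2 u, u \in K & spath K u w n.
Proof.
elim: n K w => [|n IH] K w cK wK nK.
  by exists w => //; apply: spath_refl.
have K'K : K :\ w \subset K by apply: subD1set.
have cK' : clique (K :\ w) by move=> u v /(subsetP K'K) uK /(subsetP K'K) vK; apply: cK.
have cardK' : n < #|K :\ w| by rewrite (cardsD1 w K) wK in nK; lia.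
have /card_gt0P[w' w'K] : 0 < #|K :\ w| by lia.
have [u uK pu] := IH _ _ cK' w'K cardK'.
exists u; first exact: (subsetP K'K).
have -> : K = w |: (K :\ w) by rewrite setD1K.
apply: spath_rcons pu _ _; last by rewrite !inE eqxx.
move: w'K; rewrite !inE => /andP[ww' w'K]; exact: cK.
Qed.

Lemma clique_path2 K u w n : clique K -> u \in K -> w \in K -> u != w ->
  0 < n < #|K| -> spath K u w n.
Proof.
move=> cK uK wK uw /andP[n0 nK].
have K'K : K :\ u \subset K by apply: subD1set.
have cK' : clique (K :\ u) by move=> a b /(subsetP K'K) aK /(subsetP K'K) bK; apply: cK.
have wK' : w \in K :\ u by rewrite !inE eq_sym uw.
have cardK' : n.-1 < #|K :\ u| by rewrite (cardsD1 u K) uK in nK; lia.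
have [z zK pz] := clique_path cK' wK' cardK'.
have -> : n = n.-1.+1 by lia.
have -> : K = u |: (K :\ u) by rewrite setD1K.
apply: spath_cons pz _ _; last by rewrite !inE eqxx.
move: zK; rewrite !inE => /andP[zu zK]; by apply: cK; rewrite // eq_sym.
Qed.

Definition biclique (S Q : {set T}) : Prop := {in S & Q, forall w q, e w q}.

(** An alternating path of length [2 * i] with both ends in [Q] uses [i] vertices of [S] and [i + 1]
    of [Q], which is what the two bounds provide. *)
Lemma biclique_even S Q q i : biclique S Q -> [disjoint S & Q] -> q \in Q ->
  i <= #|S| -> i < #|Q| -> exists2 q', q' \in Q & spath (S :|: Q) q' q (2 * i).
Proof.
elim: i S Q q => [|i IH] S Q q bSQ dSQ qQ iS iQ.
  by exists q => //; apply: spath_refl; rewrite inE qQ orbT.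
have /card_gt0P[w wS] : 0 < #|S| by lia.
have SS : S :\ w \subset S by apply: subD1set.
have QQ : Q :\ q \subset Q by apply: subD1set.
have b' : biclique (S :\ w) (Q :\ q).
  by move=> a b /(subsetP SS) aS /(subsetP QQ) bQ; apply: bSQ.
have d' : [disjoint S :\ w & Q :\ q] by apply: disjointWl SS (disjointWr QQ dSQ).
have cS : i <= #|S :\ w| by rewrite (cardsD1 w S) wS in iS; lia.
have cQ : i < #|Q :\ q| by rewrite (cardsD1 q Q) qQ in iQ; lia.
have /card_gt0P[q1 q1Q] : 0 < #|Q :\ q| by lia.
have [q2 q2Q p2] := IH _ _ _ b' d' q1Q cS cQ.
have wQ : w \notin Q by rewrite (disjointFr dSQ wS).
have qS : q \notin S by rewrite (disjointFl dSQ qQ).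
exists q2; first exact: (subsetP QQ).
have -> : 2 * i.+1 = (2 * i).+2 by lia.
apply: (@spath_sub (q |: (w |: (S :\ w :|: Q :\ q)))).
  by rewrite (setUA [set w]) setD1K // setUCA setD1K //.
apply: spath_rcons; last 1 first.
- rewrite !inE eqxx /= (negbTE qS) andbF !orbF.
  by apply: contraNneq qS => ->.
- apply: spath_rcons p2 _ _.
    by rewrite e_sym; apply: bSQ => //; apply: (subsetP QQ).
  by rewrite !inE eqxx (negbTE wQ) !andbF.
exact: bSQ.
Qed.

Lemma biclique_odd S Q w i : biclique S Q -> [disjoint S & Q] -> w \in S ->
  i < #|S| -> i < #|Q| ->
  exists2 q', q' \in Q & spath (S :|: Q) q' w (2 * i).+1.
Proof.
move=> bSQ dSQ wS iS iQ.
have SS : S :\ w \subset S by apply: subD1set.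
have b' : biclique (S :\ w) Q by move=> a b /(subsetP SS) aS bQ; apply: bSQ.
have d' : [disjoint S :\ w & Q] by apply: disjointWl SS dSQ.
have cS : i <= #|S :\ w| by rewrite (cardsD1 w S) wS in iS; lia.
have /card_gt0P[q qQ] : 0 < #|Q| by lia.
have [q' q'Q p'] := biclique_even b' d' qQ cS iQ.
exists q' => //.
have -> : S = w |: (S :\ w) by rewrite setD1K.
rewrite -setUA; apply: spath_rcons p' _ _; first by rewrite e_sym; apply: bSQ.
by rewrite !inE eqxx (disjointFr dSQ wS).
Qed.

(** * The weighted rooted problem *)

(** In the last condition root and target count as one neighbour each, whatever the multiplicity:
    once both are added to the graph, every part of [V] has at least two neighbours outside
    itself. *)
Definition adm V A b (k : nat) : Prop :=
  [/\ V != set0,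
      {in V, forall v, k < #|nbr v :&: V| + (v \in A) + b v}
    & forall D, D \subset V -> D != set0 ->
        1 < #|nb V D| + (A :&: D != set0) + [exists v in D, 0 < b v]].

(** The weight of the end vertex is credited to the number of lengths; when a contracted target is
    opened up again, this credit is exchanged for further lengths. *)
Definition ends V A b (k : nat) : Prop :=
  exists u n, [/\ u \in V, 0 < b u, 0 < n, k < n + b u & ap (rpath V A u) n].

Definition solved (N : nat) : Prop :=
  forall V A b k, #|V| < N -> adm V A b k -> ends V A b k.

(* A tail of length 0 enters v directly from the root. *)
Definition rtail K A v (n : nat) : Prop :=
  v \in A /\ n = 0 \/
  exists l n', [/\ l \in K, e l v, rpath K A l n' & n = n'.+1].

Lemma rtail_join K D A v z n m : [disjoint K & D] ->
  rtail K A v n -> spath D v z m -> rpath (K :|: D) A z (n + m).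
Proof.
move=> dKD [[vA ->]|[l [n' [lK elv pl ->]]]] pv.
  by exists v => //; apply: spath_sub pv; apply: subsetUr.
by rewrite addSn; apply: rpath_join pl pv elv dKD.
Qed.

Lemma card_nbrU v K D : [disjoint K & D] ->
  #|nbr v :&: (K :|: D)| = #|nbr v :&: K| + #|nbr v :&: D|.
Proof.
move=> dKD; rewrite setIUr cardsU -setIIr (disjoint_setI0 dKD) setI0 cards0.
by rewrite subn0.
Qed.

Lemma nb_sub V D : nb V D \subset V :\: D.
Proof. by apply/subsetP => w /nbP[wV wD _]; rewrite inE wD. Qed.

Lemma card_gt1_other (X : {set T}) c : 1 < #|X| -> exists2 d, d \in X & d != c.
Proof.
move=> X1; have /card_gt0P[d dX] : 0 < #|X :\ c|.
  by have := cardsD1 c X; case: (c \in X) => /=; lia.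
by exists d; move: dX; rewrite !inE => /andP[].
Qed.

Lemma disjoint_notin (X Y : {set T}) x : [disjoint X & Y] -> x \in X -> x \notin Y.
Proof. by move=> dXY xX; rewrite (disjointFr dXY xX). Qed.

(* The roles of root and target are exchanged in the recursive call: its root is
   c, and its target is the root of the original problem contracted with K. *)
Lemma hang N K D A c k :
    solved N -> #|D| < N -> conn D -> D != set0 -> [disjoint K & D] ->
    c \notin K -> c \notin D ->
    {in D, forall v, k < #|nbr v :&: (K :|: D)| + e c v + (v \in A)} ->
    (forall D2, D2 \subset D -> D2 != set0 -> 1 < #|nb (c |: (K :|: D)) D2|) ->
    (exists2 v, v \in D & e c v) ->
    {in D, forall v, ap (rtail K A v) (#|nbr v :&: K| + (v \in A))} ->
  ap (rpath (c |: (K :|: D)) A c) k.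
Proof.
move=> IH DN cD D0 dKD cK cD' deg P [d dD ecd] tails.
pose wt v := #|nbr v :&: K| + (v \in A).
have [|v [n [vD wv n0 kn Pn]]] := IH D (nbr c) wt k DN.
  split=> // [v vD|D2 D2D D20].
    by have := deg v vD; rewrite card_nbrU // in_nbr /wt; clear; lia.
  have wt_of u w : u \in D2 -> w \in K -> e u w -> [exists v in D2, 0 < wt v].
    move=> uD wK euw; apply/existsP; exists u; rewrite uD /wt addn_gt0.
    by apply/orP; left; apply/card_gt0P; exists w; rewrite inE in_nbr euw.
  have c_of u : u \in D2 -> e u c -> nbr c :&: D2 != set0.
    by move=> uD euc; apply/set0Pn; exists u; rewrite inE in_nbr e_sym euc.
  (* If [D2 = D], the part meets the neighbours of [c], and a boundary vertex other than [c] lies in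
     [K] and gives weight. If [D2] has a single neighbour in [D], a second boundary vertex is [c] or
     lies in [K]. *)
  have [n0|n0] := eqVneq (nb D D2) set0.
    have E : D2 = D by apply: cD.
    subst D2; rewrite (c_of d) // 1?e_sym //.
    have [w /nbP[wV wD [u uD euw]] wc] := card_gt1_other c (P D (subxx _) D0).
    have wK : w \in K by move: wV; rewrite !inE (negbTE wc) (negbTE wD) orbF.
    by rewrite (wt_of u w) //; clear; lia.
  have n1 : 0 < #|nb D D2| by rewrite card_gt0.
  have [n2|n2] := ltnP 1 #|nb D D2|; first by move: n2; clear; lia.
  have /card_gt0P[f fn] := n1.
  have [w /nbP[wV wD [u uD euw]] wf] := card_gt1_other f (P D2 D2D D20).
  move: wV; rewrite !inE => /orP[/eqP wc|/orP[wK|wD1]].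
  - by rewrite (c_of u) -?wc //; move: n1; clear; lia.
  - by rewrite (wt_of u w) //; move: n1; clear; lia.
  have /card_le1P/(_ f fn w) := n2.
  have -> : w \in nb D D2 by apply/nbP; split=> //; exists u.
  by rewrite [in RHS]inE (negbTE wf).
have := ap_sum n0 wv Pn (tails v vD).
move/(ap_leq (m := k)) => H; have {}H := H _; apply: (ap_add (c := 1)) (H _); last first.
  by move: kn; rewrite /wt; clear; lia.
move=> i [i1 [i2 [[c' c'c pc'] t ->]]].
have [c'D _] := spath_mem pc'.
have [x xA p] := rtail_join dKD t (spath_rev pc').
exists x => //.
have -> : i1 + i2 + 1 = (i2 + i1).+1 by clear; lia.
apply: (spath_rcons p); first by rewrite e_sym -in_nbr.
by rewrite inE negb_or cK.
Qed.

(* K is contracted into the root, which keeps only its edges to L. If the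
   contracted graph violates the cut condition, then it has a part that is
   attached by a single vertex c and sees K but not L, and [hang] applies. *)
Lemma landing N K D L A g k p :
    solved N -> #|D| < N -> conn D -> [disjoint K & D] -> L \subset K ->
    {in D, forall v, k < #|nbr v :&: (K :|: D)| + (v \in A) + g v} ->
    (forall D2, D2 \subset D -> D2 != set0 -> {in D2, forall v, g v = 0} ->
      1 < #|nb (K :|: D) D2|) ->
    (exists2 v, v \in D & 0 < g v) ->
    (exists2 v, v \in D & nbr v :&: L != set0) ->
    0 < p -> ap (fun n => {in L, forall l, rpath K A l n}) p ->
    {in D, forall v, #|nbr v :&: K| + (v \in A) < p + (nbr v :&: L != set0)} ->
    {in D, forall v, nbr v :&: L = set0 ->
      ap (rtail K A v) (#|nbr v :&: K| + (v \in A))} ->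
    0 < k ->
  ends (K :|: D) A (fun v => if v \in D then g v else 0) k.
Proof.
move=> IH DN cD dKD LK deg P [d dD gd] [f fD fL] p0 vals loss tails k0.
have D0 : D != set0 by apply/set0Pn; exists d.
pose A' := [set v | nbr v :&: L != set0].
have fA' : A' :&: D != set0 by apply/set0Pn; exists f; rewrite !inE fL.
have gD : [exists v in D, 0 < g v] by apply/existsP; exists d; rewrite dD.
have [|] := boolP [forall D2 : {set T}, (D2 \subset D) && (D2 != set0) ==>
   (1 < #|nb D D2| + (A' :&: D2 != set0) + [exists v in D2, 0 < g v])].
  move/forallP => c2.
  have [|u [n [uD gu n0 kn Pn]]] := IH D A' g (k - p.-1) DN.
    split=> // [v vD|D2 D2D D20]; last first.
      by have /implyP := c2 D2; rewrite D2D D20; apply.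
    have := deg v vD; have := loss v vD; rewrite card_nbrU // inE.
    (* When [k <= p.-1], the bound [k - p.-1] is 0 and only a positive value is asked for; the cut
       condition at the single vertex [v] supplies it. *)
    have /implyP := c2 [set v]; rewrite sub1set vD -card_gt0 cards1 => /(_ isT).
    have : #|nb D [set v]| <= #|nbr v :&: D|.
      apply: subset_leq_card; apply/subsetP => w /nbP[wD _ [v']].
      by rewrite inE => /eqP-> evw; rewrite inE in_nbr evw.
    have -> : (A' :&: [set v] != set0) = (nbr v :&: L != set0).
      apply/set0Pn/idP => [[w]|vL]; first by rewrite !inE => /andP[wL /eqP<-].
      by exists v; rewrite !inE vL eqxx.
    have -> : [exists v0 in [set v], 0 < g v0] = (0 < g v).
      apply/existsP/idP => [[w]|gv]; first by rewrite inE => /andP[/eqP->].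
      by exists v; rewrite inE eqxx.
    move: p0; clear; move: (nbr v :&: L != set0) => l.
    by case: (posnP (g v)) => [->|g0]; rewrite ?g0; lia.
  exists u, (n + p).-1; rewrite inE uD orbT; split=> //.
  - by move: n0 p0; clear; lia.
  - by move: n0 p0 kn; clear; lia.
  apply: (ap_add (c := 1)) (ap_sum n0 p0 Pn vals).
  move=> i [i1 [i2 [[v vA' pv] vl ->]]].
  move: vA'; rewrite inE => /set0Pn[l]; rewrite inE in_nbr => /andP[evl lL].
  have -> : i1 + i2 + 1 = (i2 + i1).+1 by clear; lia.
  by apply: rpath_join (vl l lL) pv _ dKD; rewrite e_sym.
rewrite negb_forall => /existsP[D1]; rewrite negb_imply -leqNgt.
move=> /andP[/andP[D1D D10]] s1.
have n0 : nb D D1 != set0.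
  apply: contraTneq s1 => n0; have E : D1 = D by apply: cD.
  by rewrite -ltnNge E fA' gD; clear; lia.
have n1 : #|nb D D1| = 1 by move: n0 s1; rewrite -card_gt0; clear; lia.
have A'1 : A' :&: D1 = set0 by apply/eqP/negPn; move: s1; rewrite n1; clear; lia.
have g1 : {in D1, forall v, g v = 0}.
  move=> v vD1; apply/eqP; rewrite -leqn0 leqNgt; apply/negP => gv.
  suff : [exists v in D1, 0 < g v] by move: s1; rewrite n1; clear; lia.
  by apply/existsP; exists v; rewrite vD1.
have /cards1P[c cE] : #|nb D D1| == 1 by rewrite n1.
have /set0Pn[v0 v0D1] := D10.
(* [hang] needs a connected part; a component of [D1] still has no neighbour in [D] other than
   [c]. *)
set C := component D1 v0.
have CD1 : C \subset D1 by apply: comp_sub.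
have CD := subset_trans CD1 D1D.
have C0 : C != set0 by apply/set0Pn; exists v0; apply: comp_id.
have /nbP[cD' cD1 _] : c \in nb D D1 by rewrite cE inE.
have cC : c \notin C by apply: contra cD1; apply: (subsetP CD1).
have nC : nb D C \subset [set c].
  rewrite -cE; apply/subsetP => w /nbP[wD wC [v vC evw]].
  apply/nbP; split=> //; last by exists v => //; apply: (subsetP CD1).
  by apply: contra wC => wD1; apply: comp_step evw.
have nC0 : nb D C != set0.
  by apply: conn_nb => //; apply: contraNneq cC => ->.
have eC : exists2 v, v \in C & e c v.
  have /set0Pn[w wn] := nC0; have := subsetP nC w wn; rewrite inE => /eqP wc.
  by move/nbP: wn => [_ _ [v vC evw]]; exists v; rewrite // e_sym -wc.
have dKC : [disjoint K & C] by apply: disjointWr dKD.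
have inD v w : v \in C -> w \in D -> e v w -> w \in c |: C.
  move=> vC wD evw; rewrite in_setU; case wC : (w \in C); first by rewrite orbT.
  by rewrite orbF; apply: (subsetP nC); apply/nbP; rewrite wC; split=> //; exists v.
have vL v : v \in C -> nbr v :&: L = set0.
  move=> vC; apply/eqP/negPn/negP => h; have : v \in A' :&: D1.
    by rewrite !inE h (subsetP CD1).
  by rewrite A'1 inE.
have H : ap (rpath (c |: (K :|: C)) A c) k.
  apply: (@hang N) => //.
  - by apply: leq_ltn_trans DN; apply: subset_leq_card.
  - exact: comp_conn.
  - by apply: contraL cD' => /(disjoint_notin dKD).
  - move=> v vC; have := deg v (subsetP CD _ vC).
    rewrite g1 ?(subsetP CD1) // addn0 !card_nbrU //.
    suff : #|nbr v :&: D| <= e c v + #|nbr v :&: C| by clear; lia.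
    apply: (@leq_trans #|(nbr v :&: [set c]) :|: (nbr v :&: C)|).
      apply: subset_leq_card; apply/subsetP => w; rewrite inE in_nbr => /andP[evw wD].
      by rewrite -setIUr !inE evw; have := inD v w vC wD evw; rewrite !inE.
    apply: leq_trans (leq_card_setU _ _) _; rewrite leq_add2r.
    case ecv: (e c v).
      by apply: leq_trans (subset_leq_card (subsetIr _ _)) _; rewrite cards1.
    rewrite leqn0 cards_eq0 -subset0; apply/subsetP => w; rewrite !inE.
    by move=> /andP[evw /eqP wc]; move: ecv; rewrite -wc e_sym evw.
  - move=> D2 D2C D20.
    have g2 : {in D2, forall v, g v = 0}.
      by move=> v vD2; apply: g1; apply: (subsetP CD1); apply: (subsetP D2C).
    apply: leq_trans (P D2 (subset_trans D2C CD) D20 g2) _.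
    apply: subset_leq_card; apply/subsetP => w /nbP[wKD wD2 [v vD2 evw]].
    apply/nbP; split=> //; last by exists v.
    move: wKD; rewrite inE => /orP[wK|wD]; first by rewrite !inE wK orbT.
    have := inD v w (subsetP D2C _ vD2) wD evw.
    by rewrite !in_setU => /orP[->//|->]; rewrite !orbT.
  - by move=> v vC; apply: tails; [apply: (subsetP CD) | apply: vL].
(* The [k] lengths end at [c]. One fixed path outside [C] prolongs them to positive weight: [C]
   carries none, and [D] is connected. *)
have [m [y [gy pm]]] : exists m y, 0 < g y /\ spath (D :\: C) c y m.
  set E := component (D :\: C) c.
  have cDC : c \in D :\: C by rewrite inE cC.
  have ED : E \subset D :\: C by apply: comp_sub.
  have [|noE] := boolP [exists y in E, 0 < g y].
    move=> /existsP[y /andP[yE gy]].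
    have [m pm] := conn_spath (comp_conn cDC) (comp_id _ _) yE.
    by exists m, y; split=> //; apply: spath_sub pm.
  have CE : C :|: E = D.
    apply: cD.
    - by rewrite subUset CD (subset_trans ED) // subsetDl.
    - by apply: contraNneq C0 => CE0; rewrite -subset0 -CE0 subsetUl.
    apply/eqP; rewrite -subset0; apply/subsetP => w /nbP[wD].
    rewrite inE negb_or => /andP[wC wE] [v]; rewrite inE => /orP[vC|vE] evw.
      have := inD v w vC wD evw; rewrite in_setU (negbTE wC) orbF inE => /eqP wc.
      by move: wE; rewrite wc comp_id.
    by case/negP: wE; apply: comp_step evw => //; rewrite inE wC.
  move: dD; rewrite -CE inE => /orP[dC|dE].
    by move: gd; rewrite g1 // (subsetP CD1).
  by case/negP: noE; apply/existsP; exists d; rewrite dE.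
have [_ yDC] := spath_mem pm.
have yD : y \in D by move: yDC; rewrite inE => /andP[].
exists y, k; rewrite inE yD orbT; split=> //; first by move: gy; clear; lia.
apply: (ap_add (c := m)) H => i [x xA px]; exists x => //.
apply: spath_sub (spath_cat px pm _).
  rewrite !subUset sub1set !inE cD' orbT subsetUl (subset_trans CD) ?subsetUr //.
  by rewrite (subset_trans (subsetDl _ _)) // subsetUr.
apply/subsetP => w; rewrite !inE => /andP[/orP[/eqP-> //|/orP[wK|->//]]].
by rewrite (disjointFr dKD wK) andbF.
Qed.

(** With one vertex [u] as target all weights are at most 1, so [landing] gives at least [k]
    lengths, and one more edge leads to [u]. If no vertex of [D] sees [L], landing is impossible,
    and [u] takes the place of the cut vertex in [hang]. *)
Lemma retarget N K D L A u k p :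
    solved N -> #|D| < N -> conn D -> [disjoint K & D] -> L \subset K ->
    u \notin K -> u \notin D -> (exists2 v, v \in D & e u v) ->
    {in D, forall v, k < #|nbr v :&: (K :|: D)| + (v \in A) + e u v} ->
    (forall D2, D2 \subset D -> D2 != set0 -> 1 < #|nb (u |: (K :|: D)) D2|) ->
    0 < p -> ap (fun n => {in L, forall l, rpath K A l n}) p ->
    {in D, forall v, #|nbr v :&: K| + (v \in A) < p + (nbr v :&: L != set0)} ->
    {in D, forall v, nbr v :&: L = set0 ->
      ap (rtail K A v) (#|nbr v :&: K| + (v \in A))} ->
    0 < k ->
  ap (rpath (u |: (K :|: D)) A u) k.
Proof.
move=> IH DN cD dKD LK uK uD [d dD eud] deg P p0 vals loss tails k0.
have D0 : D != set0 by apply/set0Pn; exists d.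
have [|noL] := boolP [exists v in D, nbr v :&: L != set0].
  move=> /existsP[f /andP[fD fL]].
  have [|||x [n [xKD + n0 kn Pn]]] :=
    @landing N K D L A (fun v => nat_of_bool (e u v)) k p IH DN cD dKD LK
      deg _ _ _ p0 vals loss tails k0.
  - move=> D2 D2D D20 g0; apply: leq_trans (P D2 D2D D20) _.
    apply: subset_leq_card; apply/subsetP => w /nbP[].
    rewrite in_setU1 => /orP[/eqP-> _ [v vD2]|wV wD2 [v vD2 evw]].
      by have := g0 v vD2; rewrite e_sym; case: (e v u).
    by apply/nbP; split=> //; exists v.
  - by exists d; rewrite ?eud.
  - by exists f.
  case xD: (x \in D) => // eux.
  apply: (ap_leq (m := k) (n := n)).
    by move: kn; rewrite xD; case: (e u x); clear; lia.
  apply: (ap_add (c := 1)) Pn => i [y yA py]; exists y => //; rewrite addn1.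
  apply: (spath_rcons py); first by rewrite e_sym; case: (e u x) eux.
  by rewrite in_setU negb_or uK.
have vL v : v \in D -> nbr v :&: L = set0.
  move=> vD; apply/eqP/negPn/negP => h; case/negP: noL.
  by apply/existsP; exists v; rewrite vD.
apply: (@hang N) => //.
- by move=> v /deg; rewrite addnAC.
- by exists d.
by move=> v vD; apply: tails => //; apply: vL.
Qed.

(* Z is contracted into the target, and the paths found in the rest of the graph
   are extended through Z. *)
Lemma compose N V Z A a b k :
    solved N -> #|V| <= N -> adm V A b k -> Z \subset V -> Z != set0 ->
    a \in A -> a \in V :\: Z ->
    {in V :\: Z, forall v, nbr v :&: Z != set0 -> exists u p,
      [/\ u \in Z, 0 < b u, 0 < p,
          (b v + #|nbr v :&: Z| < p + b u) || (k < p + b u)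
        & ap (fun n => exists2 l, e v l & spath Z l u n) p]} ->
  ends V A b k.
Proof.
move=> IH VN [V0 deg cut] ZV Z0 aA aVZ tails.
set C := component (V :\: Z) a.
have CVZ : C \subset V :\: Z by apply: comp_sub.
have CV : C \subset V by apply: subset_trans CVZ (subsetDl _ _).
have aC : a \in C by apply: comp_id.
have ZC : [disjoint Z & C].
  rewrite disjoint_sym; apply: disjointWl CVZ _.
  by rewrite disjoints_subset setDE subsetIr.
have C0 : C != set0 by apply/set0Pn; exists a.
have inC v w : v \in C -> w \in V -> e v w -> w \in Z :|: C.
  move=> vC wV evw; rewrite in_setU; case wZ: (w \in Z) => //=.
  by apply: comp_step evw => //; rewrite in_setD wZ.
have cC : conn C by apply: comp_conn.
have CN : #|C| < N.
  apply: leq_trans VN; apply: proper_card; rewrite properE CV /=.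
  have /set0Pn[z zZ] := Z0; apply/subsetPn; exists z; first exact: (subsetP ZV).
  by rewrite (disjointFr ZC zZ).
pose b' v := b v + #|nbr v :&: Z|.
have [|v [n [vC bv n0 kn Pn]]] := IH C A b' k CN.
  split=> // [v vC|D DC D0].
    have := deg v (subsetP CV _ vC).
    suff : #|nbr v :&: V| <= #|nbr v :&: Z| + #|nbr v :&: C|.
      by rewrite /b'; clear; lia.
    rewrite -card_nbrU //; apply: subset_leq_card; apply/subsetP => w.
    by rewrite !in_setI in_nbr => /andP[evw wV]; rewrite evw; apply: inC evw.
  have [|noZ] := boolP [exists v in D, nbr v :&: Z != set0].
    move=> /existsP[z /andP[zD zZ]].
    have -> : [exists v in D, 0 < b' v].
      by apply/existsP; exists z; rewrite zD /b' addn_gt0 [X in _ || X]card_gt0 zZ orbT.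
    have [n0|n0] := eqVneq (nb C D) set0; last first.
      by move: n0; rewrite -card_gt0; clear; lia.
    rewrite (cC D DC D0 n0).
    suff -> : A :&: C != set0 by clear; lia.
    by apply/set0Pn; exists a; rewrite in_setI aA.
  have := cut D (subset_trans DC CV) D0.
  have : #|nb V D| <= #|nb C D|.
    apply: subset_leq_card; apply/subsetP => w /nbP[wV wD [v vD evw]].
    apply/nbP; split=> //; last by exists v.
    have := inC v w (subsetP DC _ vD) wV evw; rewrite in_setU => /orP[wZ|//].
    case/negP: noZ; apply/existsP; exists v; rewrite vD; apply/set0Pn; exists w.
    by rewrite in_setI in_nbr evw.
  have : [exists v in D, 0 < b v] <= [exists v in D, 0 < b' v].
    case: existsP => // -[v /andP[vD bv]]; case: existsP => // -[]; exists v.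
    by rewrite vD /b' addn_gt0 bv.
  by clear; lia.
have [vZ|vZ] := eqVneq (nbr v :&: Z) set0.
  exists v, n; move: bv kn; rewrite /b' vZ cards0 addn0 => bv kn.
  split=> //; first exact: (subsetP CV).
  by apply: ap_imp Pn => i; apply: rpath_sub.
(* The weight [b' v] is repaid by [p - 1] additional lengths together with [b u]; in the second
   alternative the tails suffice by themselves. *)
have [u [p [uZ bu p0 kp Pp]]] := tails v (subsetP CVZ _ vC) vZ.
exists u, (n + p).-1; split=> //; first exact: (subsetP ZV).
- by move: n0 p0; clear; lia.
- by move: n0 p0 kp kn; rewrite /b'; clear; lia.
apply: (ap_add (c := 1)) (ap_sum n0 p0 Pn Pp).
move=> i [i1 [i2 [pv [l evl pl] ->]]].
have -> : i1 + i2 + 1 = (i1 + i2).+1 by clear; lia.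
apply: (@rpath_sub (C :|: Z)); first by rewrite subUset CV.
by apply: rpath_join pv pl evl _; rewrite disjoint_sym.
Qed.

(** If [v] sees [u] and another vertex of [Z], all lengths below [#|Z|] occur. If [v] misses [u],
    the length 0 is lost, but then [v] has at most [#|Z| - 1] neighbours in [Z]. *)
Lemma clique_tails Z u v : clique Z -> u \in Z -> nbr v :&: Z != set0 ->
  ap (fun n => exists2 l, e v l & spath Z l u n) #|nbr v :&: Z|.
Proof.
move=> cZ uZ /set0Pn[l]; rewrite in_setI in_nbr => /andP[evl lZ].
have [lu|lu] := eqVneq l u.
  subst l.
  have [/subset_leq_card|] := boolP (nbr v :&: Z \subset [set u]).
    rewrite cards1 => X1; apply: (ap_leq X1); apply: (ap1 (a := 0)).
    by exists u => //; apply: spath_refl.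
  move=> /subsetPn[l]; rewrite in_setI in_nbr inE => /andP[evl' lZ'] lu.
  apply: (@ap_range _ 0) => i; rewrite add0n /= => iX.
  have [->|i0] := posnP i; first by exists u => //; apply: spath_refl.
  exists l => //; apply: clique_path2 => //; rewrite i0 /=.
  by apply: leq_trans iX _; apply: subset_leq_card; apply: subsetIr.
case euv : (e v u).
  apply: (@ap_range _ 0) => i; rewrite add0n /= => iX.
  have [->|i0] := posnP i; first by exists u => //; apply: spath_refl.
  exists l => //; apply: clique_path2 => //; rewrite i0 /=.
  by apply: leq_trans iX _; apply: subset_leq_card; apply: subsetIr.
have X1 : #|nbr v :&: Z| <= #|Z :\ u|.
  apply: subset_leq_card; apply/subsetP => w; rewrite in_setI in_nbr => /andP[evw wZ].
  by rewrite in_setD1 wZ andbT; apply: contraTneq evw => ->; rewrite euv.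
apply: (@ap_range _ 1) => i iX; exists l => //; apply: clique_path2 => //.
by have := cardsD1 u Z; rewrite uZ; move: iX X1; clear; lia.
Qed.

Lemma clique_tails2 Z u v l : clique Z -> u \in Z -> l \in Z -> l != u ->
  e v u -> e v l -> ap (fun n => exists2 l, e v l & spath Z l u n) #|Z|.
Proof.
move=> cZ uZ lZ lu evu evl; apply: (@ap_range _ 0) => i; rewrite add0n /= => iX.
have [->|i0] := posnP i; first by exists u => //; apply: spath_refl.
by exists l => //; apply: clique_path2 => //; rewrite i0.
Qed.

(** * Reductions *)

(** The set [V] itself has empty boundary, so its cut condition needs both the root and the
    target. *)
Lemma adm_target V A b k : adm V A b k -> exists2 y, y \in V & 0 < b y.
Proof.
move=> [V0 _ cut]; have := cut V (subxx _) V0.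
have -> : nb V V = set0.
  by apply/eqP; rewrite -subset0 -(setDv V); apply: nb_sub.
rewrite cards0; case: existsP => [[y /andP[yV by0]] _|_].
  by exists y.
by case: (A :&: V != set0).
Qed.

Lemma adm_root V A b k : adm V A b k -> A :&: V != set0.
Proof.
move=> [V0 _ cut]; have := cut V (subxx _) V0.
have -> : nb V V = set0.
  by apply/eqP; rewrite -subset0 -(setDv V); apply: nb_sub.
by rewrite cards0; case: (A :&: V != set0) => //; case: ([exists _ in _, _]).
Qed.

Lemma ends_sub V W A b k : V \subset W -> ends V A b k -> ends W A b k.
Proof.
move=> VW [u [n [uV bu n0 kn Pn]]]; exists u, n; split=> //.
  exact: (subsetP VW).
by apply: ap_imp Pn => i; apply: rpath_sub.
Qed.

(** A proper part with empty boundary is a smaller instance with the same roots and weights. *)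
Lemma adm_conn N V A b k : solved N -> #|V| <= N -> adm V A b k ->
  conn V \/ ends V A b k.
Proof.
move=> IH VN [V0 deg cut].
have [|] := boolP [forall D : {set T},
   [&& D \subset V, D != set0 & nb V D == set0] ==> (D == V)].
  move=> /forallP c; left=> D DV D0 nD; apply/eqP; have /implyP := c D.
  by apply; rewrite DV D0 nD eqxx.
rewrite negb_forall => /existsP[D]; rewrite negb_imply.
move=> /andP[/and3P[DV D0 /eqP nD] DneV]; right.
have inD v w : v \in D -> w \in V -> e v w -> w \in D.
  move=> vD wV evw; apply: contra_eqT nD => wD; apply/set0Pn; exists w.
  by apply/nbP; split=> //; exists v.
apply: ends_sub (DV) _; apply: IH.
  by apply: leq_trans VN; apply: proper_card; rewrite properEneq DneV.
split=> // [v vD|D2 D2D D20].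
  apply: leq_trans (deg v (subsetP DV _ vD)) _; rewrite !leq_add2r.
  apply: subset_leq_card; apply/subsetP => w; rewrite !in_setI in_nbr.
  by move=> /andP[evw wV]; rewrite evw; apply: inD evw.
apply: leq_trans (cut D2 (subset_trans D2D DV) D20) _; rewrite !leq_add2r.
apply: subset_leq_card; apply/subsetP => w /nbP[wV wD [v vD evw]].
apply/nbP; split=> //; last by exists v.
exact: inD (subsetP D2D _ vD) wV evw.
Qed.

(** If a weightless part [D] has only one neighbour [c], then [c] serves as target for [D]: at least
    [k] lengths reach [c], and a path outside [D] carries them on to positive weight. Hence
    weightless parts may be assumed to have two neighbours without counting the root. *)
Lemma adm_cut N V A b k D : solved N -> #|V| <= N -> adm V A b k -> conn V ->
    D \subset V -> D != set0 -> {in D, forall v, b v = 0} ->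
  1 < #|nb V D| \/ ends V A b k.
Proof.
move=> IH VN admV cV DV D0 bD.
have [y yV by0] := adm_target admV.
have [V0 deg cut] := admV.
have yD : y \notin D by apply: contraTN by0 => /bD->.
have DneV : D != V by apply: contraNneq yD => ->.
have [n1|n1] := ltnP 1 #|nb V D|; [by left | right].
have n1' : #|nb V D| == 1.
  by have := conn_nb cV DV D0 DneV; rewrite -card_gt0; move: n1; clear; lia.
have /cards1P[c cE] := n1'.
have /nbP[cV' cD _] : c \in nb V D by rewrite cE inE.
have inD v w : v \in D -> w \in V -> e v w -> w \in c |: D.
  move=> vD wV evw; rewrite in_setU; case wD : (w \in D); first by rewrite orbT.
  by rewrite orbF -cE; apply/nbP; rewrite wD; split=> //; exists v.
have [||u [n [uD euc n0 kn Pn]]] := IH D A (fun v => nat_of_bool (e v c)) k.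
- by apply: leq_trans VN; apply: proper_card; rewrite properEneq DneV.
- split=> // [v vD|D2 D2D D20].
    have := deg v (subsetP DV _ vD); rewrite bD // addn0.
    suff : #|nbr v :&: V| <= #|nbr v :&: D| + e v c by clear; lia.
    apply: (@leq_trans #|(nbr v :&: [set c]) :|: (nbr v :&: D)|).
      apply: subset_leq_card; apply/subsetP => w; rewrite in_setI in_nbr.
      by move=> /andP[evw wV]; rewrite -setIUr in_setI in_nbr evw; apply: inD evw.
    apply: leq_trans (leq_card_setU _ _) _; rewrite addnC leq_add2l.
    case ecv: (e v c).
      by apply: leq_trans (subset_leq_card (subsetIr _ _)) _; rewrite cards1.
    rewrite leqn0 cards_eq0 -subset0; apply/subsetP => w; rewrite !inE.
    by move=> /andP[evw /eqP wc]; move: ecv; rewrite -wc evw.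
  have := cut D2 (subset_trans D2D DV) D20.
  have -> : [exists v in D2, 0 < b v] = false.
    by apply/existsP => -[v /andP[vD]]; rewrite bD // (subsetP D2D).
  suff : #|nb V D2| <= #|nb D D2| + [exists v in D2, 0 < e v c] by clear; lia.
  case: existsP => [_|noc].
    apply: (@leq_trans #|[set c] :|: nb D D2|).
      apply: subset_leq_card; apply/subsetP => w /nbP[wV wD [v vD evw]].
      have := inD v w (subsetP D2D _ vD) wV evw; rewrite !in_setU => /orP[->//|wD'].
      by apply/orP; right; apply/nbP; split=> //; exists v.
    by apply: leq_trans (leq_card_setU _ _) _; rewrite cards1 addnC.
  rewrite addn0; apply: subset_leq_card; apply/subsetP => w /nbP[wV wD [v vD evw]].
  have := inD v w (subsetP D2D _ vD) wV evw; rewrite in_setU1 => /orP[/eqP wc|wD'].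
    by case: noc; exists v; rewrite vD -wc evw.
  by apply/nbP; split=> //; exists v.
set E := component (V :\: D) c.
have cVD : c \in V :\: D by rewrite in_setD cD.
have EVD : E \subset V :\: D by apply: comp_sub.
have DE : D :|: E = V.
  apply: cV.
  - by rewrite subUset DV (subset_trans EVD) // subsetDl.
  - by apply: contraNneq D0 => DE0; rewrite -subset0 -DE0 subsetUl.
  apply/eqP; rewrite -subset0; apply/subsetP => w /nbP[wV].
  rewrite in_setU negb_or => /andP[wD wE] [v]; rewrite in_setU => /orP[vD|vE] evw.
    have := inD v w vD wV evw; rewrite in_setU1 (negbTE wD) orbF => /eqP wc.
    by move: wE; rewrite wc comp_id.
  by case/negP: wE; apply: comp_step evw => //; rewrite in_setD wD.
have yE : y \in E by move: yV; rewrite -DE in_setU (negbTE yD).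
have [m pm] := conn_spath (comp_conn cVD) (comp_id _ _) yE.
exists y, n; split=> //; first by move: kn by0; case: (e u c) => /=; clear; lia.
apply: (ap_add (c := m.+1)) Pn => i pi; rewrite addnS -DE.
apply: rpath_join pi pm _ _; first by case: (e u c) euc.
rewrite disjoint_sym; apply: disjointWl EVD _.
by rewrite disjoints_subset setDE subsetIr.
Qed.

(** All paths start at [a], so [a] itself can be the root of the instance on [V :\ a]. *)
Lemma adm_root1 N V a b k : solved N -> #|V| <= N -> adm V [set a] b k ->
  a \in V -> ends V [set a] b k.
Proof.
move=> IH VN [V0 deg cut] aV.
have [Va|Va] := eqVneq (V :\ a) set0.
  have VE : V = [set a] by rewrite -(setD1K aV) Va setU0.
  exists a, 1; have := deg a aV; rewrite VE inE eqxx.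
  have -> : nbr a :&: [set a] = set0.
    apply/eqP; rewrite -subset0; apply/subsetP => w; rewrite !inE => /andP[eaw /eqP wa].
    by move: eaw; rewrite wa e_irr.
  have := cut V (subxx _) V0; rewrite VE.
  have -> : nb [set a] [set a] = set0.
    by apply/eqP; rewrite -subset0 -(setDv [set a]); apply: nb_sub.
  rewrite cards0 add0n => H kb.
  have ba : 0 < b a.
    case: existsP H => [[w /andP[]]|_]; first by rewrite inE => /eqP->.
    by case: (_ != set0).
  split=> //; apply: (ap1 (a := 0)); exists a; rewrite ?inE //.
  by apply: spath_refl; rewrite inE.
have [||u [n [uV bu n0 kn Pn]]] := IH (V :\ a) (nbr a) b k.
- by apply: leq_trans VN; rewrite (cardsD1 a V) aV.
- split=> // [v|D DV D0].
    rewrite in_setD1 => /andP[va vV]; have := deg v vV.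
    rewrite (cardsD1 a) in_setI in_nbr aV andbT inE (negbTE va) setIDA e_sym in_nbr.
    by clear; lia.
  have aD : a \notin D.
    by apply: contraTN DV => aD; apply/subsetPn; exists a; rewrite ?inE ?eqxx.
  have := cut D (subset_trans DV (subsetDl _ _)) D0.
  have -> : [set a] :&: D == set0 by rewrite setI_eq0 disjoints1.
  have := cardsD1 a (nb V D).
  have -> : (a \in nb V D) = (nbr a :&: D != set0).
    apply/nbP/set0Pn => [[_ _ [v vD eva]]|[v]].
      by exists v; rewrite inE in_nbr e_sym eva.
    by rewrite inE in_nbr e_sym => /andP[eva vD]; split=> //; exists v.
  suff -> : nb V D :\ a = nb (V :\ a) D by move=> -> /=; rewrite addn0 [_ + #|_|]addnC.
  by apply/setP => w; rewrite !inE andbA.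
exists u, n; split=> //; first by move: uV; rewrite in_setD1 => /andP[].
apply: (ap_add (c := 1)) Pn => i [x]; rewrite in_nbr => eax px.
exists a; rewrite ?inE // addn1 -(setD1K aV).
by apply: spath_cons px eax _; rewrite !inE eqxx.
Qed.

(* Splitting the path just before its middle gives two distances differing by
   one or two. *)
Lemma spath_mid W x y m : spath W x y m -> 0 < m ->
  exists2 u, u \in W & exists2 h, spath W x u h &
    spath W y u h.+1 \/ spath W y u h.+2.
Proof.
move=> [p [ep lp up pW sp]] m0.
pose h := m.-1./2.
have hm : h < m.+1 by rewrite /h; clear -m0; lia.
pose u := nth x (x :: p) h; exists u.
  by apply: pW; apply: mem_nth; rewrite /= sp.
have pE : p = take h p ++ drop h p by rewrite cat_take_drop.
have lu : last x (take h p) = u.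
  rewrite (last_nth x) size_take sp.
  have -> : (if h < m then h else m) = h by rewrite /h; clear -m0; case: ltnP; lia.
  by rewrite -[x :: take h p]/(take h.+1 (x :: p)) nth_take.
move: ep up lp; rewrite pE cat_path last_cat lu -cat_cons cat_uniq.
move=> /andP[e1 e2] /and3P[u1 u2 u3] lp.
exists h.
  exists (take h p); split=> //.
    by move=> z; rewrite inE => /orP[/eqP->|/mem_take zp]; apply: pW;
      rewrite inE ?eqxx ?zp ?orbT.
  by rewrite size_take sp; rewrite /h; clear -m0; case: ltnP; lia.
have H : spath W u y (m - h).
  exists (drop h p); split=> //.
  - rewrite cons_uniq u3 andbT; apply: contra u2 => ud; apply/hasP; exists u => //.
    by rewrite -lu mem_last.
  - move=> z; rewrite inE => /orP[/eqP->|/mem_drop zp]; apply: pW; last by rewrite inE zp orbT.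
    by apply: mem_nth; rewrite /= sp.
  - by rewrite size_drop sp.
have := odd_double_half m.-1; rewrite -/h => mE.
have {}H := spath_rev H; case om : (odd m.-1) mE => mE; [right|left].
  by have -> : h.+2 = m - h by move: mE m0; clear; lia.
by have -> : h.+1 = m - h by move: mE m0; clear; lia.
Qed.

Lemma conn_mid W x y (P : T -> Prop) : conn W -> x \in W -> y \in W -> x != y ->
    P x -> P y -> exists2 u, u \in W & ap (fun n => exists2 l, P l & spath W l u n) 2.
Proof.
move=> cW xW yW xy Px Py; have [m pm] := conn_spath cW xW yW.
have m0 : 0 < m.
  by case: m pm => // -[[|c p] [_ /= yx _ _ //]]; rewrite yx eqxx in xy.
have [u uW [h xu yu]] := spath_mid pm m0; exists u => //.
case: yu => yu; [exists h, 1; split; first by left | exists h, 2; split; first by right].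
  by move=> [|[|//]] _; [exists x | exists y]; rewrite // ?muln0 ?addn0 ?muln1 ?addn1.
by move=> [|[|//]] _; [exists x | exists y]; rewrite // ?muln0 ?addn0 ?muln1 ?addn2.
Qed.

(** The normal form left by [solved_step]. The bound [j.+1 < k] says that neither one nor two
    lengths ending at a vertex of maximal weight [j] would suffice. *)
Definition core V A b k (j : nat) : Prop :=
  [/\ [/\ adm V A b k, conn V, A \subset V & 1 < #|A|],
      forall D, D \subset V -> D != set0 -> {in D, forall v, b v = 0} ->
        1 < #|nb V D|,
      {in V, forall v, b v <= j},
      {in V, forall v, b v = j -> exists w, [/\ w \in V, e v w & b w = j]}
    & [/\ exists2 v, v \in V & b v = j, 0 < j & j.+1 < k]].

Lemma solved_step N : solved N ->
    (forall V A b k j, #|V| <= N -> core V A b k j -> ends V A b k) ->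
  solved N.+1.
Proof.
move=> IH coreN V A0 b k; rewrite ltnS => VN adm0.
pose A := A0 :&: V.
have AV : A \subset V by apply: subsetIr.
suff H : adm V A b k -> ends V A b k.
  have [|u [n [uV bu n0 kn Pn]]] := H.
    case: adm0 => V0 deg cut; split=> // [v vV|D DV D0].
      by rewrite /A in_setI vV andbT; apply: deg.
    by rewrite /A -setIA (setIidPr DV); apply: cut.
  exists u, n; split=> //; apply: ap_imp Pn => i [x]; rewrite in_setI => /andP[xA _] px.
  by exists x.
move=> admV.
have [cV|//] := adm_conn IH VN admV.
have [y yV by0] := adm_target admV.
have /set0Pn[a] := adm_root admV; rewrite in_setI => /andP[aA aV].
have [|noD] := boolP [exists D : {set T}, [&& D \subset V, D != set0,
   [forall v in D, b v == 0] & #|nb V D| <= 1]].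
  move=> /existsP[D /and4P[DV D0 /forallP bD nD]].
  have [] // := adm_cut IH VN admV cV DV D0.
    by move=> v vD; apply/eqP; have /implyP := bD v; apply.
  by rewrite ltnNge nD.
have cut D : D \subset V -> D != set0 -> {in D, forall v, b v = 0} -> 1 < #|nb V D|.
  move=> DV D0 bD; rewrite ltnNge; apply/negP => nD; case/negP: noD.
  apply/existsP; exists D; rewrite DV D0 nD andbT /=; apply/forallP => v.
  by apply/implyP => /bD->.
have [A1|A1] := leqP #|A| 1.
  have /cards1P[a' AE] : #|A| == 1 by rewrite eqn_leq A1; apply/card_gt0P; exists a.
  by move: admV aA AV aV; rewrite AE => admV _; rewrite sub1set => a'V _;
    apply: (adm_root1 IH).
have [u uV umax] : exists2 u, u \in V & {in V, forall v, b v <= b u}.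
  by case: (@arg_maxnP _ y [in V] b yV) => u uV um; exists u.
have j0 : 0 < b u by apply: leq_trans by0 (umax y yV).
have [kb|bk] := leqP k (b u).
  exists u, 1; split=> //.
  have [n pn] := conn_spath cV aV uV.
  by apply: (ap1 (a := n)); exists a.
(* A vertex of maximal weight without a neighbour of the same weight is contracted into the target:
   a neighbour [v] has [b v + 1 <= b z], so a single tail pays for it. *)
have dU z : b z = b u -> z \in V -> {in V, forall w, e z w -> b w <> b u} -> ends V A b k.
  move=> bz zV iso.
  have [a' a'A a'z] := card_gt1_other z A1.
  apply: (@compose N V [set z] A a') => //.
  - by rewrite sub1set.
  - by apply/set0Pn; exists z; rewrite inE.
  - by rewrite in_setD1 a'z (subsetP AV).
  move=> v; rewrite in_setD1 => /andP[vz vV] /set0Pn[w].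
  rewrite in_setI in_nbr inE => /andP[evw /eqP wz]; subst w.
  exists z, 1; rewrite inE eqxx bz; split=> //.
    have := umax v vV; have := iso v vV; rewrite e_sym evw => /(_ isT).
    have : #|nbr v :&: [set z]| <= 1.
      by rewrite -(cards1 z); apply: subset_leq_card; apply: subsetIr.
    by clear; lia.
  by apply: (ap1 (a := 0)); exists z => //; apply: spath_refl; rewrite inE.
(* If [k] is at most [b u + 1], two lengths suffice; they come from entering a component of the
   vertices of maximal weight at two places and stopping near the middle between them. *)
have [kb|bk'] := leqP k (b u).+1; last first.
  have [|noz] := boolP [exists z in V, (b z == b u) &&
      [forall w in V, e z w ==> (b w != b u)]].
    move=> /existsP[z /and3P[zV /eqP bz /forallP iso]]; apply: (dU z) => //.
    by move=> w wV ezw; apply/eqP; have /implyP/(_ wV)/implyP := iso w; apply.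
  apply: (coreN V A b k (b u)) => //; split=> //; last by split=> //; exists u.
  move=> v vV bv.
  have [|no] := boolP [exists w in V, e v w && (b w == b u)].
    by move=> /existsP[w /and3P[wV evw /eqP bw]]; exists w.
  case/negP: noz; apply/existsP; exists v; rewrite vV bv eqxx /=.
  apply/forallP => w; apply/implyP => wV; apply/implyP => evw.
  by apply: contraNneq no => bw; apply/existsP; exists w; rewrite wV evw bw eqxx.
pose B := [set v in V | b v == b u].
have uB : u \in B by rewrite inE uV eqxx.
pose Z := component B u.
have ZB : Z \subset B by apply: comp_sub.
have BV : B \subset V by apply/subsetP => w; rewrite inE => /andP[].
have ZV := subset_trans ZB BV.
have bZ z : z \in Z -> b z = b u.
  by move/(subsetP ZB); rewrite inE => /andP[_ /eqP].
have cZ : conn Z by apply: comp_conn.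
have [AZ|/subsetPn[a' a'A a'Z]] := boolP (A \subset Z).
  have [a' a'A a'a] := card_gt1_other a A1.
  have [|z zZ Pz] := @conn_mid Z a a' (fun l => l \in A) cZ
    (subsetP AZ _ aA) (subsetP AZ _ a'A) _ aA a'A; first by rewrite eq_sym.
  exists z, 2; rewrite (bZ z) //; split=> //; first exact: (subsetP ZV).
  by apply: ap_imp Pz => i [l lA pl]; exists l => //; apply: spath_sub pl.
apply: (@compose N V Z A a') => //.
- by apply/set0Pn; exists u; apply: comp_id.
- by rewrite in_setD a'Z (subsetP AV).
move=> v; rewrite in_setD => /andP[vZ vV] vnZ.
have bv : b v < b u.
  rewrite ltn_neqAle umax // andbT; apply: contraNneq vZ => bv.
  have /set0Pn[w] := vnZ; rewrite in_setI in_nbr => /andP[evw wZ].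
  by apply: comp_step (wZ) _ _ => //; rewrite 1?e_sym // inE vV bv eqxx.
have [X1|X1] := leqP #|nbr v :&: Z| 1.
  have /set0Pn[w] := vnZ; rewrite in_setI in_nbr => /andP[evw wZ].
  exists w, 1; rewrite bZ //; split=> //; first by move: X1 bv; clear; lia.
  by apply: (ap1 (a := 0)); exists w => //; apply: spath_refl.
have /card_gt0P[w wX] := ltnW X1.
have [w' w'X w'w] := card_gt1_other w X1.
move: wX w'X; rewrite !in_nbrI => /andP[evw wZ] /andP[evw' w'Z].
have [|z zZ Pz] := @conn_mid Z w w' (fun l => e v l) cZ wZ w'Z _ evw evw'.
  by rewrite eq_sym.
by exists z, 2; rewrite bZ //; split=> //; rewrite orbC ltnS ltnS (leq_trans kb).
Qed.

(** * Contractions in an instance in normal form *)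

Section Core.

Variables (N k j : nat) (V A : {set T}) (b : T -> nat).
Hypothesis IH : solved N.
Hypothesis VN : #|V| <= N.
Hypothesis coreV : core V A b k j.

Let admV : adm V A b k. Proof. by case: coreV => -[]. Qed.
Let cV : conn V. Proof. by case: coreV => -[]. Qed.
Let AV : A \subset V. Proof. by case: coreV => -[]. Qed.
Let A_gt1 : 1 < #|A|. Proof. by case: coreV => -[]. Qed.
Let cut D : D \subset V -> D != set0 -> {in D, forall v, b v = 0} -> 1 < #|nb V D|.
Proof. by case: coreV => _ + _ _ _; apply. Qed.
Let deg v : v \in V -> k < #|nbr v :&: V| + (v \in A) + b v.
Proof. by case: admV => _ + _; apply. Qed.
Let b_max v : v \in V -> b v <= j.
Proof. by case: coreV => _ _ + _ _; apply. Qed.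
Let B_nbr v : v \in V -> b v = j -> exists w, [/\ w \in V, e v w & b w = j].
Proof. by case: coreV => _ _ _ + _; apply. Qed.
Let B_ex : exists2 v, v \in V & b v = j. Proof. by case: coreV => _ _ _ _ []. Qed.
Let j_gt0 : 0 < j. Proof. by case: coreV => _ _ _ _ []. Qed.
Let j_lt : j.+1 < k. Proof. by case: coreV => _ _ _ _ []. Qed.

Lemma comp_in K x v w : x \in V :\: K -> v \in component (V :\: K) x ->
  w \in V -> e v w -> w \in K :|: component (V :\: K) x.
Proof.
move=> xVK vC wV evw; rewrite in_setU; case wK: (w \in K) => //=.
by apply: comp_step evw => //; rewrite in_setD wK.
Qed.

Lemma comp_deg K x v : x \in V :\: K -> v \in component (V :\: K) x ->
  #|nbr v :&: V| <= #|nbr v :&: (K :|: component (V :\: K) x)|.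
Proof.
move=> xVK vC; apply: subset_leq_card; apply/subsetP => w.
by rewrite !in_nbrI => /andP[evw wV]; rewrite evw; apply: comp_in evw.
Qed.

Lemma comp_disj K x : x \in V :\: K -> [disjoint K & component (V :\: K) x].
Proof.
move=> xVK; rewrite disjoint_sym; apply: disjointWl (comp_sub xVK) _.
by rewrite disjoints_subset setDE subsetIr.
Qed.

Lemma comp_V K x : x \in V :\: K -> component (V :\: K) x \subset V.
Proof. by move/(comp_sub)/subset_trans; apply; apply: subsetDl. Qed.

Lemma comp_lt K x : x \in V :\: K -> K :&: V != set0 ->
  #|component (V :\: K) x| < N.
Proof.
move=> xVK /set0Pn[z]; rewrite in_setI => /andP[zK zV]; apply: leq_trans VN.
apply: proper_card; rewrite properE comp_V //; apply/subsetPn; exists z => //.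
by rewrite (disjointFr (comp_disj xVK) zK).
Qed.

Lemma comp_nbr K x : x \in V :\: K -> K :&: V != set0 ->
  exists2 v, v \in component (V :\: K) x & nbr v :&: K != set0.
Proof.
move=> xVK K0; have C0 : component (V :\: K) x != set0.
  by apply/set0Pn; exists x; apply: comp_id.
have [|w /nbP[wV wC [v vC evw]]] := set0Pn _ (conn_nb cV (comp_V xVK) C0 _).
  apply: contraTneq K0 => E; rewrite negbK -E setI_eq0; exact: comp_disj.
exists v => //; apply/set0Pn; exists w; rewrite in_nbrI evw /=.
by have := comp_in xVK vC wV evw; rewrite in_setU (negbTE wC) orbF.
Qed.

(** [landing] for the case that weight is left outside [K]; the condition on weightless parts is the
    one in [core]. *)
Lemma land_core K L x p :
    let D := component (V :\: K) x in
    K \subset V -> L \subset K -> x \in V :\: K ->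
    0 < b x -> (exists2 v, v \in D & nbr v :&: L != set0) ->
    0 < p -> ap (fun n => {in L, forall l, rpath K A l n}) p ->
    {in D, forall v, #|nbr v :&: K| + (v \in A) < p + (nbr v :&: L != set0)} ->
    {in D, forall v, nbr v :&: L = set0 ->
      ap (rtail K A v) (#|nbr v :&: K| + (v \in A))} ->
  ends V A b k.
Proof.
move=> D KV LK xVK bx [f fD fL] p0 vals loss tails.
have DV : D \subset V := comp_V xVK.
have KDV : K :|: D \subset V by rewrite subUset KV.
have [||||||u [n []]] := @landing N K D L A b k p IH _ (comp_conn xVK)
    (comp_disj xVK) LK _ _ _ _ p0 vals loss tails.
- apply: comp_lt => //; have /set0Pn[l] := fL; rewrite in_nbrI => /andP[_ lL].
  apply/set0Pn; exists l; rewrite in_setI (subsetP KV) ?(subsetP LK) //.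
- move=> v vD; apply: leq_trans (deg (subsetP DV _ vD)) _.
  by rewrite !leq_add2r; apply: comp_deg.
- move=> D2 D2D D20 b2; apply: leq_trans (cut (subset_trans D2D DV) D20 b2) _.
  apply: subset_leq_card; apply/subsetP => w /nbP[wV wD [v vD evw]].
  apply/nbP; split=> //; last by exists v.
  exact: comp_in (subsetP D2D _ vD) wV evw.
- by exists x => //; apply: comp_id.
- by exists f.
- by move: j_lt; clear; lia.
case: ifP => // uD _ bu n0 kn Pn; exists u, n; split=> //; first exact: (subsetP DV).
by apply: ap_imp Pn => i; apply: rpath_sub.
Qed.

(** For the case that no weight is left outside [u |: K]: the vertex [u] becomes the target, and [k]
    lengths ending there suffice because [b u] is positive. *)
Lemma retarget_core K L u x p :
    K \subset V -> L \subset K -> u \in V -> u \notin K -> 0 < b u ->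
    x \in V :\: (u |: K) -> e u x ->
    {in V :\: (u |: K), forall v, b v = 0} ->
    0 < p -> ap (fun n => {in L, forall l, rpath K A l n}) p ->
    {in V :\: (u |: K), forall v,
      #|nbr v :&: K| + (v \in A) < p + (nbr v :&: L != set0)} ->
    {in V :\: (u |: K), forall v, nbr v :&: L = set0 ->
      ap (rtail K A v) (#|nbr v :&: K| + (v \in A))} ->
  ends V A b k.
Proof.
move=> KV LK uV uK bu xVK eux b0 p0 vals loss tails.
set D := component (V :\: (u |: K)) x.
have DV : D \subset V := comp_V xVK.
have /subsetP DVK : D \subset V :\: (u |: K) by apply: comp_sub.
have := comp_disj xVK; rewrite -/D => dD.
have uD : u \notin D by rewrite (disjointFr dD) // setU11.
have E : u |: (K :|: D) = (u |: K) :|: D by rewrite setUA.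
have dKD : [disjoint K & D] by apply: disjointWl dD; apply: subsetUr.
have H : ap (rpath (u |: (K :|: D)) A u) k.
  apply: (@retarget N K D L A u k p) => //.
  - by apply: comp_lt => //; apply/set0Pn; exists u; rewrite in_setI setU11.
  - exact: comp_conn.
  - by exists x => //; apply: comp_id.
  - move=> v vD; have := deg (subsetP DV _ vD); rewrite b0 ?DVK // addn0.
    suff : #|nbr v :&: V| <= #|nbr v :&: (K :|: D)| + e u v by clear; lia.
    apply: (leq_trans (comp_deg xVK vD)); rewrite -/D -E.
    apply: (@leq_trans #|(nbr v :&: [set u]) :|: (nbr v :&: (K :|: D))|).
      by rewrite -setIUr.
    apply: leq_trans (leq_card_setU _ _) _; rewrite addnC leq_add2l e_sym.
    case evu: (e v u).
      by apply: leq_trans (subset_leq_card (subsetIr _ _)) _; rewrite cards1.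
    rewrite leqn0 cards_eq0 -subset0; apply/subsetP => w.
    by rewrite in_nbrI inE => /andP[evw /eqP wu]; rewrite -wu evw in evu.
  - move=> D2 D2D D20.
    have b2 : {in D2, forall v, b v = 0}.
      by move=> v /(subsetP D2D) vD; apply: b0; apply: DVK.
    apply: leq_trans (cut (subset_trans D2D DV) D20 b2) _.
    apply: subset_leq_card; apply/subsetP => w /nbP[wV wD [v vD evw]].
    apply/nbP; rewrite E; split=> //; last by exists v.
    exact: comp_in (subsetP D2D _ vD) wV evw.
  - by move=> v /DVK; apply: loss.
  - by move=> v /DVK; apply: tails.
  - by move: j_lt; clear; lia.
exists u, k; split=> //; try by move: j_lt bu; clear; lia.
by apply: ap_imp H => i; apply: rpath_sub; rewrite E !subUset sub1set uV KV.
Qed.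

(** The tails through [Z] give as many lengths as [v] has edges to [Z], so [b v < j] is all that
    [compose] still asks for. *)
Lemma clique_compose Z u a : clique Z -> Z \subset V -> u \in Z -> b u = j ->
    a \in A -> a \notin Z -> {in V :\: Z, forall v, b v < j} -> ends V A b k.
Proof.
move=> cZ ZV uZ bu aA aZ bZ.
apply: (@compose N V Z A a) => //.
- by apply/set0Pn; exists u.
- by rewrite in_setD aZ (subsetP AV).
move=> v vVZ vZ; exists u, #|nbr v :&: Z|; split=> //; rewrite ?bu ?card_gt0 //.
  by have := bZ v vVZ; clear; lia.
exact: clique_tails.
Qed.

Definition cliqueb K := [forall u in K, forall v in K, (u != v) ==> e u v].

Lemma cliqueP K : reflect (clique K) (cliqueb K).
Proof.
apply: (iffP forallP) => [h u v uK vK uv|h u].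
  by have /implyP/(_ uK)/forallP/(_ v)/implyP/(_ vK)/implyP := h u; apply.
apply/implyP => uK; apply/forallP => v; apply/implyP => vK; apply/implyP; exact: h.
Qed.

Lemma max_clique W x y : x \in W -> y \in W -> e x y ->
  exists K, [/\ K \subset W, clique K, 1 < #|K|
    & {in W :\: K, forall v, ~~ (K \subset nbr v)}].
Proof.
move=> xW yW exy; pose P K := (K \subset W) && cliqueb K.
have xy : x != y by apply: contraTneq exy => ->; rewrite e_irr.
have P0 : P [set x; y].
  rewrite /P subUset !sub1set xW yW; apply/cliqueP => u v.
  by rewrite !inE => /orP[]/eqP-> /orP[]/eqP->; rewrite ?eqxx // e_sym.
case: (@arg_maxnP _ _ P (fun K => #|K|) P0) => K /andP[KW /cliqueP cK] Kmax.
exists K; split=> //; first by have := Kmax _ P0; rewrite cards2 xy.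
move=> v; rewrite in_setD => /andP[vK vW]; apply/negP => Kv.
have : P (v |: K).
  rewrite /P subUset sub1set vW KW; apply/cliqueP => u w.
  have ev z : z \in K -> e v z by move/(subsetP Kv); rewrite in_nbr.
  rewrite !in_setU1 => /orP[/eqP->|uK] /orP[/eqP->|wK]; rewrite ?eqxx //.
  - by move=> _; apply: ev.
  - by move=> _; rewrite e_sym; apply: ev.
  exact: cK.
by move/Kmax; rewrite cardsU1 vK /= /geq /= ltnn.
Qed.

(** * Adjacent roots *)

Lemma adjacent_roots x y : x \in A -> y \in A -> e x y -> ends V A b k.
Proof.
move=> xA yA exy; have [K [KA cK K1 Kmax]] := max_clique xA yA exy.
have KV := subset_trans KA AV.
have [|noY] := boolP [exists y in V :\: K, 0 < b y].
  move=> /existsP[z /andP[zVK bz]].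
  apply: (@land_core K K z #|K|) => //.
  - apply: comp_nbr => //; rewrite (setIidPl KV) -card_gt0; exact: ltnW.
  - exact: ltnW.
  - apply: (@ap_range _ 0) => i /andP[_ iK] l lK.
    have [u uK pu] := clique_path cK lK iK.
    by exists u => //; apply: (subsetP KA).
  - move=> v vD; have := subsetP (comp_sub zVK) _ vD.
    rewrite in_setD => /andP[vK vV].
    have [->|vK0] := eqVneq (nbr v :&: K) set0.
      by rewrite cards0; move: K1; case: (v \in A) => /=; clear; lia.
    case vA: (v \in A) => /=; last first.
      by rewrite addn0 addn1 ltnS; apply: subset_leq_card; apply: subsetIr.
    (* A root outside the maximal clique misses one of its vertices, which offsets its own edge to
       the root. *)
    rewrite !addn1 ltnS; apply: proper_card; rewrite properE subsetIr subsetI subxx andbT.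
    by apply: Kmax; rewrite in_setD vK.
  move=> v vD ->; rewrite cards0 add0n; case vA: (v \in A).
    by apply: (ap1 (a := 0)); left.
  by apply: (@ap_range _ 0).
have b0 v : v \in V -> v \notin K -> b v = 0.
  move=> vV vK; apply/eqP; rewrite -leqn0 leqNgt; apply: contra noY => bv.
  by apply/existsP; exists v; rewrite in_setD vK vV.
have inK v : v \in V -> 0 < b v -> v \in K.
  by move=> vV; apply: contraLR => /(b0 _ vV)->.
have [u uV bu] := B_ex; have uK : u \in K by apply: inK; rewrite ?bu.
(* All weight lies in [K]. A vertex of [K] of weight below [j], or a vertex of [A] outside [K], is
   kept as a root while the rest of the clique is contracted into the target. *)
have [|bK] := boolP [exists a in K, b a < j].
  move=> /existsP[a /andP[aK ba]].
  have KaK : K :\ a \subset K by apply: subD1set.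
  apply: (@clique_compose (K :\ a) u a) => //.
  - by move=> v w /(subsetP KaK) vK /(subsetP KaK) wK; apply: cK.
  - exact: subset_trans KV.
  - by rewrite in_setD1 uK andbT; apply: contraTneq ba => <-; rewrite bu ltnn.
  - exact: (subsetP KA).
  - by rewrite in_setD1 eqxx.
  move=> v; rewrite in_setD in_setD1 negb_and negbK => /andP[/orP[/eqP->//|vK] vV].
  by rewrite b0.
have {bK} bK v : v \in K -> b v = j.
  move=> vK; apply/eqP; rewrite eqn_leq b_max ?(subsetP KV) //= leqNgt.
  by apply: contra bK => bv; apply/existsP; exists v; rewrite vK.
have [AK|/subsetPn[a aA aK]] := boolP (A \subset K); last first.
  apply: (@clique_compose K u a) => // v; rewrite in_setD => /andP[vK vV].
  by rewrite b0.
have {AK} E : A = K by apply/eqP; rewrite eqEsubset AK.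
(* Now [A = K] has constant weight [j]. A vertex [w] of [K] with a neighbour outside becomes the
   target and [K :\ w] is contracted into the root; without such a vertex [V = K] is complete. *)
have [|noX] := boolP [exists v in K, nbr v :&: (V :\: K) != set0].
  move=> /existsP[w /andP[wK /set0Pn[z]]]; rewrite in_nbrI => /andP[ewz zVK].
  have KwK : K :\ w \subset K by apply: subD1set.
  have cKw : clique (K :\ w).
    by move=> v v' /(subsetP KwK) vK /(subsetP KwK) v'K; apply: cK.
  have Kw0 : 0 < #|K :\ w| by move: K1; rewrite (cardsD1 w) wK.
  apply: (@retarget_core (K :\ w) (K :\ w) w z #|K :\ w|); rewrite ?setD1K //.
  - exact: subset_trans KV.
  - exact: (subsetP KV).
  - by rewrite in_setD1 eqxx.
  - by rewrite bK.
  - by move=> v; rewrite in_setD => /andP[vK vV]; apply: b0.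
  - apply: (@ap_range _ 0) => i /andP[_ iK] l lK.
    have [v vK pv] := clique_path cKw lK iK.
    by exists v => //; rewrite E; apply: (subsetP KwK).
  - move=> v; rewrite in_setD E => /andP[/negbTE-> vV]; rewrite addn0.
    case: eqVneq => [->|_]; first by rewrite cards0 addn0.
    by rewrite addn1 ltnS; apply: subset_leq_card; apply: subsetIr.
  move=> v; rewrite in_setD E => /andP[/negbTE-> vV] ->; rewrite cards0.
  by apply: (@ap_range _ 0).
have {noX} VK : V = K.
  apply/esym; apply: cV => //; first by apply/set0Pn; exists u.
  apply/eqP; rewrite -subset0; apply/subsetP => w /nbP[wV wK [v vK evw]].
  case/negP: noX; apply/existsP; exists v; rewrite vK; apply/set0Pn; exists w.
  by rewrite in_nbrI evw in_setD wK.
exists u, #|K|; split=> //; [by rewrite bu | exact: ltnW | | ].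
  have := deg uV; rewrite E uK.
  suff : #|nbr u :&: V| < #|K| by clear; lia.
  rewrite VK; apply: proper_card; rewrite properE subsetIr; apply/subsetPn; exists u => //.
  by rewrite in_nbrI e_irr.
apply: (@ap_range _ 0) => i /andP[_ iK].
have [v vK pv] := clique_path cK uK iK.
by rewrite VK E; exists v.
Qed.

(** * An edge among the common neighbours of two roots *)

Lemma card_nbr1 v x K : x \notin K -> #|nbr v :&: (x |: K)| = e v x + #|nbr v :&: K|.
Proof.
move=> xK; rewrite (cardsD1 x) in_nbrI setU11 andbT; congr (_ + _).
apply: eq_card => w; rewrite in_setD1 !in_nbrI in_setU1.
by case: eqVneq => //= ->; rewrite (negbTE xK) andbF.
Qed.

(** Every vertex of a maximal clique [R] among the common neighbours is reached with all lengths
    from 1 to [#|R| + 1]. By maximality no vertex outside sees [q1], [q2] and all of [R], so these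
    lengths pay for the loss. *)
Lemma adjacent_common q1 q2 x y : {in A &, forall u v, e u v = false} ->
    q1 \in A -> q2 \in A -> q1 != q2 ->
    x \in nbr q1 :&: nbr q2 :&: V -> y \in nbr q1 :&: nbr q2 :&: V -> e x y ->
  ends V A b k.
Proof.
move=> Aind q1A q2A q12 xM yM exy; have [R [RM cR R1 Rmax]] := max_clique xM yM exy.
have RP l : l \in R -> [/\ e q1 l, e q2 l & l \in V].
  by move/(subsetP RM); rewrite in_setI in_nbrI in_nbr => /andP[/andP[-> ->]].
have RA l : l \in R -> l \notin A.
  by move=> /RP[el _ _]; apply: contraTN el => lA; rewrite Aind.
have q1R : q1 \notin R by apply: contraTN q1A; apply: RA.
have q2R : q2 \notin R by apply: contraTN q2A; apply: RA.
have RV : R \subset V by apply/subsetP => l /RP[].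
have R0 : R != set0 by rewrite -card_gt0; apply: ltnW.
set K := q1 |: (q2 |: R).
have q1K : q1 \notin q2 |: R by rewrite in_setU1 negb_or q12.
have RK : R \subset K by rewrite /K setUA; apply: subsetUr.
have KV : K \subset V by rewrite !subUset !sub1set !(subsetP AV).
have cardK v : #|nbr v :&: K| = e v q1 + (e v q2 + #|nbr v :&: R|).
  by rewrite /K !card_nbr1.
have vA0 v : v \in A -> #|nbr v :&: K| = #|nbr v :&: R|.
  by move=> vA; rewrite cardK !Aind.
have cardR v : #|nbr v :&: R| <= #|R| by apply: subset_leq_card; apply: subsetIr.
have p0 q l i : q \in A -> q \notin R -> (forall l, l \in R -> e q l) -> l \in R ->
    0 < i <= #|R| -> spath (q |: R) q l i.
  move=> qA qR eq lR /andP[i0 iR]; have i' : i.-1 < #|R| by rewrite prednK.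
  have [w wR pw] := clique_path cR lR i'.
  by rewrite -(prednK i0); apply: spath_cons pw _ qR; apply: eq.
have q1P l i : l \in R -> 0 < i <= #|R| -> rpath K A l i.
  move=> lR iR; exists q1 => //; apply: (@spath_sub (q1 |: R)).
    by rewrite /K setUCA; apply: subsetUr.
  by apply: p0 => // l' /RP[].
have [r rR] := set0Pn _ R0; have [eq1r eq2r rV] := RP r rR.
have q2P : rpath K A q2 2.
  exists q1 => //; rewrite /K setUCA; apply: (@spath_rcons _ _ r).
  - by apply: p0 => //; [move=> l' /RP[] | rewrite /= ltnW].
  - by rewrite e_sym.
  - by rewrite in_setU1 negb_or eq_sym q12.
have q1P2 : rpath K A q1 2.
  exists q2 => //; rewrite /K; apply: (@spath_rcons _ _ r).
  - by apply: p0 => //; [move=> l' /RP[] | rewrite /= ltnW].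
  - by rewrite e_sym.
  - by [].
(* The path runs through [q1], [r'], [q2] and then all of [R :\ r']: three edges and [#|R| - 2]
   more. *)
have longP l : l \in R -> rpath K A l #|R|.+1.
  move=> lR; have [r' r'R r'l] := card_gt1_other l R1.
  have r'q1 : e q1 r' by have [] := RP _ r'R.
  have r'q2 : e r' q2 by have [_ + _] := RP _ r'R; rewrite e_sym.
  have lR' : l \in R :\ r' by rewrite in_setD1 eq_sym r'l.
  have cR' : clique (R :\ r').
    move=> u v /(subsetP (subD1set _ _)) uR /(subsetP (subD1set _ _)) vR; exact: cR.
  have [|w wR pw] := @clique_path _ l #|R|.-2 cR' lR'.
    by have := cardsD1 r' R; rewrite r'R; move: R1; clear; lia.
  have wR' : w \in R by apply: (subsetP (subD1set R r')).
  exists q1 => //; have -> : #|R|.+1 = #|R|.-2.+3 by move: R1; clear; lia.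
  have -> : K = q1 |: (r' |: (q2 |: R :\ r')) by rewrite (setUCA [set r']) setD1K.
  apply: (@spath_cons _ r') => //; last by rewrite setUCA setD1K.
  apply: (@spath_cons _ q2) => //.
    apply: spath_cons pw _ _; first by have [] := RP _ wR'.
    by rewrite in_setD1 negb_and (negbTE q2R) orbT.
  by rewrite in_setU1 in_setD1 eqxx orbF; apply: contraNneq q2R => <-.
have tails v : nbr v :&: R = set0 -> v \notin K ->
    ap (rtail K A v) (#|nbr v :&: K| + (v \in A)).
  move=> vR vK; rewrite cardK vR cards0 addn0.
  have qq q : q \in A -> q \in K -> e v q -> rtail K A v 1.
    move=> qA qK evq; right; exists q, 0; split=> //; first by rewrite e_sym.
    by exists q => //; apply: spath_refl.
  case vA: (v \in A).
    by rewrite !Aind //; apply: (ap1 (a := 0)); left.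
  have q1K' : q1 \in K by rewrite setU11.
  have q2K' : q2 \in K by rewrite /K setUCA setU11.
  case ev1: (e v q1); case ev2: (e v q2); rewrite ?addn0 ?add0n.
  (* Length 1 comes directly from [q1], length 3 from [q1], [r], [q2]. *)
  - exists 1, 2; split; first by right.
    move=> [|[|//]] _; first exact: qq ev1.
    by right; exists q2, 2; split=> //; rewrite e_sym.
  - by apply: (ap1 (a := 1)); apply: qq ev1.
  - by apply: (ap1 (a := 1)); apply: qq ev2.
  - by apply: (@ap_range _ 0).
have [|noY] := boolP [exists z in V :\: K, 0 < b z].
  move=> /existsP[z /andP[zVK bz]]; set D := component (V :\: K) z.
  have DP v : v \in D -> v \in V /\ v \notin K.
    by move/(subsetP (comp_sub zVK)); rewrite in_setD => /andP[].
  have [|noR] := boolP [exists v in D, nbr v :&: R != set0].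
    move=> /existsP[f /andP[fD fR]].
    apply: (@land_core K R z #|R|.+1) => //.
    - by exists f.
    - apply: (@ap_range _ 1) => i /andP[i0]; rewrite addnS add1n !ltnS leq_eqVlt.
      by move=> /orP[/eqP-> l|iR l lR]; [apply: longP | apply: q1P; rewrite ?i0].
    - move=> v vD; have [vV vK] := DP v vD.
      case vA: (v \in A).
        rewrite vA0 //; have := cardR v.
        case: eqVneq => [->|_]; rewrite ?cards0 /=; move: R1; clear; lia.
      case: eqVneq => [vR|_].
        by rewrite cardK vR cards0; move: R1; case: (e v q1); case: (e v q2); clear; lia.
      suff : #|nbr v :&: K| < #|R|.+2 by clear; lia.
      rewrite cardK ltnNge; apply/negP => h; have := cardR v => h2.
      have [ev1 ev2 h3] : [/\ e v q1, e v q2 & #|R| <= #|nbr v :&: R|].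
        by move: h h2; clear; case: (e v q1); case: (e v q2) => h h2; split; lia.
      have vR : v \notin R by apply: contra vK; apply: (subsetP RK).
      have := Rmax v; rewrite in_setD vR in_setI in_setI !in_nbr !(e_sym _ v).
      rewrite ev1 ev2 vV => /(_ isT)/negP; apply; apply/setIidPr/eqP.
      by rewrite eqEcard subsetIr.
    by move=> v vD vR; apply: tails => //; have [] := DP v vD.
  have vR v : v \in D -> nbr v :&: R = set0.
    move=> vD; apply/eqP/negPn; apply: contra noR => h.
    by apply/existsP; exists v; rewrite vD.
  have nK v : v \in D -> nbr v :&: K = nbr v :&: [set q1; q2].
    by move=> vD; rewrite /K setUA setIUr vR // setU0.
  (* The component sees only [q1] and [q2] in [K]. Each of them is reached with length 0, and from
     the other one through [r] with length 2. *)
  apply: (@land_core K [set q1; q2] z 2) => //.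
  - by rewrite /K setUA subsetUl.
  - have [|v vD h] := comp_nbr zVK _; last by exists v => //; rewrite -nK.
    by rewrite (setIidPl KV); apply/set0Pn; exists q1; rewrite setU11.
  - exists 0, 2; split; first by right.
    have refl q : q \in A -> q \in K -> rpath K A q 0.
      by move=> qA qK; exists q => //; apply: spath_refl.
    move=> [|[|//]] _ l; rewrite in_set2 => /orP[]/eqP-> //.
      by apply: refl; rewrite // setU11.
    by apply: refl; rewrite // /K setUCA setU11.
  - move=> v vD; rewrite -nK //; case vA: (v \in A).
      by rewrite vA0 // vR // cards0; clear; lia.
    case: eqVneq => [->|_]; first by rewrite cards0.
    by rewrite cardK vR // cards0; case: (e v q1); case: (e v q2).
  move=> v vD h; rewrite -nK // in h.
  by apply: tails; [apply: vR | have [] := DP v vD].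
have b0 v : v \in V -> v \notin K -> b v = 0.
  move=> vV vK; apply/eqP; rewrite -leqn0 leqNgt; apply: contra noY => bv.
  by apply/existsP; exists v; rewrite in_setD vK vV.
have inK v : v \in V -> b v = j -> v \in K.
  by move=> vV bv; apply: contraLR j_gt0 => /(b0 _ vV); rewrite -bv => ->.
(* Two adjacent vertices of weight [j] lie in [K]; since [q1] and [q2] are not adjacent, one of the
   two is in [R]. *)
have [u uR bu] : exists2 u, u \in R & b u = j.
  have [u uV bu] := B_ex; have [w [wV euw bw]] := B_nbr uV bu.
  have := inK u uV bu; have := inK w wV bw; rewrite /K !in_setU1.
  move=> /or3P[/eqP wq|/eqP wq|wR] /or3P[/eqP uq|/eqP uq|uR]; try by [exists u | exists w];
  by move: euw; rewrite wq uq Aind.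
apply: (@compose N V (q2 |: R) A q1) => //.
- by apply: subset_trans KV; apply: subsetUr.
- by apply/set0Pn; exists q2; rewrite setU11.
- by rewrite in_setD q1K (subsetP AV).
have cZ : clique (q2 |: R).
  move=> v w; rewrite !in_setU1 => /orP[/eqP->|vR] /orP[/eqP->|wR]; rewrite ?eqxx //.
  - by move=> _; have [] := RP w wR.
  - by move=> _; rewrite e_sym; have [] := RP v vR.
  exact: cR.
have uZ : u \in q2 |: R by rewrite in_setU1 uR orbT.
move=> v; rewrite in_setD => /andP[vZ vV] vZ0.
(* Only [q1] may have weight outside the contracted clique, possibly [j]. It misses [q2] but can use
   all [#|R| + 1] lengths, one more than its number of edges. *)
have [vq|vq] := eqVneq v q1.
  have [r' r'R r'u] := card_gt1_other u R1.
  have [eu _ _] := RP u uR; have [er _ _] := RP r' r'R.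
  exists u, #|q2 |: R|; split=> //; first by rewrite bu.
  - by rewrite cardsU1 q2R.
  - have h : #|nbr v :&: (q2 |: R)| <= #|R|.
      by rewrite card_nbr1 // vq Aind // cardR.
    have := b_max vV; move: h; rewrite bu cardsU1 q2R; clear; lia.
  - by rewrite vq; apply: (@clique_tails2 _ _ _ r') => //; rewrite in_setU1 r'R orbT.
exists u, #|nbr v :&: (q2 |: R)|; split=> //; rewrite ?bu // ?card_gt0 //.
  rewrite b0 //; first by move: j_gt0; clear; lia.
  by rewrite /K in_setU1 negb_or vq.
exact: clique_tails.
Qed.

(** * No edge among the common neighbours of two roots *)

Lemma bic_vals S Q : biclique S Q -> [disjoint S & Q] -> Q \subset A ->
  #|S| < #|Q| -> ap (fun n => {in Q, forall l, rpath (S :|: Q) A l n}) #|S|.+1.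
Proof.
move=> bSQ dSQ QA SQ; exists 0, 2; split; first by right.
move=> i iS l lQ; have [q qQ pq] := biclique_even bSQ dSQ lQ iS (leq_trans iS SQ).
by exists q => //; apply: (subsetP QA).
Qed.

(** Odd paths ending in [S], plus the edge to [v], give the tails 2, 4, 6 and so on; if [v] is a
    root, the direct tail 0 precedes them in the same progression. *)
Lemma bic_tails S Q v : biclique S Q -> [disjoint S & Q] -> Q \subset A ->
    #|S| < #|Q| -> (v \in A -> #|nbr v :&: S| < #|S|) -> nbr v :&: Q = set0 ->
  ap (rtail (S :|: Q) A v) (#|nbr v :&: (S :|: Q)| + (v \in A)).
Proof.
move=> bSQ dSQ QA SQ vS vQ; rewrite card_nbrU // vQ cards0 addn0.
have cS : #|nbr v :&: S| <= #|S| by apply: subset_leq_card; apply: subsetIr.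
have [->|/set0Pn[w]] := eqVneq (nbr v :&: S) set0.
  rewrite cards0 add0n; case vA: (v \in A); last exact: (@ap_range _ 0).
  by apply: (ap1 (a := 0)); left.
rewrite in_nbrI => /andP[evw wS].
have tail i : i < #|S| -> rtail (S :|: Q) A v (2 * i).+2.
  move=> iS; have [q qQ pq] := biclique_odd bSQ dSQ wS iS (ltn_trans iS SQ).
  right; exists w, (2 * i).+1; rewrite in_setU wS e_sym; split=> //.
  by exists q => //; apply: (subsetP QA).
case vA: (v \in A) vS => vS.
  exists 0, 2; split=> [|[|i]]; [by right | by left | ].
  rewrite addn1 ltnS => iS; rewrite add0n mulnS add2n; apply: tail.
  exact: ltn_trans iS (vS isT).
exists 2, 2; split=> [|i]; first by right.
by rewrite addn0 add2n => iS; apply: tail; apply: leq_trans iS cS.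
Qed.

Lemma bic_loss S Q v : [disjoint S & Q] ->
    (v \in A -> nbr v :&: Q = set0 /\ #|nbr v :&: S| < #|S|) ->
    (1 < #|nbr v :&: Q| -> nbr v :&: S = set0 /\ #|nbr v :&: Q| <= #|S|.+1) ->
  #|nbr v :&: (S :|: Q)| + (v \in A) < #|S|.+1 + (nbr v :&: Q != set0).
Proof.
move=> dSQ hA h2; rewrite card_nbrU // -card_gt0.
have cS : #|nbr v :&: S| <= #|S| by apply: subset_leq_card; apply: subsetIr.
case: (v \in A) hA => [/(_ isT)[-> h]|_].
  by move: h; rewrite cards0; clear; lia.
have [/h2[-> h]|h] := ltnP 1 #|nbr v :&: Q|; first by move: h; rewrite cards0; clear; lia.
by move: h cS; clear; lia.
Qed.

Definition common S := [set a in A | S \subset nbr a].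

Lemma commonP S a : reflect (a \in A /\ {in S, forall w, e w a}) (a \in common S).
Proof.
rewrite inE; apply: (iffP andP) => -[aA h]; split=> //.
  by move=> w /(subsetP h); rewrite in_nbr e_sym.
by apply/subsetP => w /h; rewrite in_nbr e_sym.
Qed.

Lemma common_sub S : common S \subset A.
Proof. by apply/subsetP => a /commonP[]. Qed.

Lemma common_biclique S : biclique S (common S).
Proof. by move=> w a wS /commonP[_]; apply. Qed.

(** The strict inequality lets an alternating path use all of [S] and still have both ends in
    [common S], so that the lengths 0, 2, ..., [2 * #|S|] are available. *)
Definition bicore S := (S \subset V) && (#|S| < #|common S|).

Section Independent.

Hypothesis Aind : {in A &, forall u v, e u v = false}.
Hypothesis Mind : forall q1 q2, q1 \in A -> q2 \in A -> q1 != q2 ->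
  {in nbr q1 :&: nbr q2 :&: V &, forall x y, e x y = false}.

Lemma bicore_notin S w : bicore S -> w \in S -> w \notin A.
Proof.
move=> /andP[_ h] wS; have /card_gt0P[a /commonP[aA aS]] := leq_ltn_trans (leq0n _) h.
by apply: contraTN (aS _ wS) => wA; rewrite Aind.
Qed.

Lemma bicore_disj S : bicore S -> [disjoint S & common S].
Proof.
move=> h; rewrite disjoints_subset; apply/subsetP => w wS; rewrite in_setC.
apply: contra (bicore_notin h wS); exact: (subsetP (common_sub S)).
Qed.

Lemma bicore_ind S : bicore S -> {in S &, forall x y, e x y = false}.
Proof.
move=> /andP[/subsetP SV h] x y xS yS.
have S0 : 0 < #|S| by apply/card_gt0P; exists x.
have S1 : 1 < #|common S| by apply: leq_ltn_trans h.
have /card_gt0P[q1 q1C] := ltnW S1; have [q2 q2C q21] := card_gt1_other q1 S1.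
have /commonP[q1A q1S] := q1C; have /commonP[q2A q2S] := q2C.
by apply: (Mind q1A q2A); rewrite 1?eq_sym // !in_setI !in_nbr SV //
  !(e_sym q1) !(e_sym q2) q1S // q2S.
Qed.

Lemma out_root S v : v \notin common S -> v \in A ->
  nbr v :&: common S = set0 /\ #|nbr v :&: S| < #|S|.
Proof.
move=> vC vA; split.
  apply/eqP; rewrite -subset0; apply/subsetP => q; rewrite in_nbrI => /andP[evq].
  by move/(subsetP (common_sub S)) => qA; rewrite Aind in evq.
apply: proper_card; rewrite properE subsetIr subsetI subxx andbT.
by apply: contra vC => vS; rewrite inE vA.
Qed.

(** With two roots in common, [v] and any vertex of [S] are common neighbours of these roots, hence
    not adjacent by [Mind]. *)
Lemma out_two S v : bicore S -> v \in V -> 1 < #|nbr v :&: common S| ->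
  nbr v :&: S = set0.
Proof.
move=> /andP[/subsetP SV _] vV h.
have /card_gt0P[q1 q1X] := ltnW h; have [q2 q2X q21] := card_gt1_other q1 h.
move: q1X q2X; rewrite !in_nbrI => /andP[ev1 /commonP[q1A q1S]] /andP[ev2 /commonP[q2A q2S]].
apply/eqP; rewrite -subset0; apply/subsetP => w; rewrite in_nbrI => /andP[evw wS].
have : e v w = false.
  apply: (Mind q1A q2A); rewrite 1?eq_sym // !in_setI !in_nbr !(e_sym q1) !(e_sym q2).
    by rewrite ev1 ev2.
  by rewrite q1S // q2S // SV.
by rewrite evw.
Qed.

Lemma bicore_add S v : bicore S -> v \in V -> v \notin S ->
  #|S|.+1 < #|nbr v :&: common S| -> bicore (v |: S).
Proof.
move=> /andP[SV _] vV vS h; rewrite /bicore subUset sub1set vV SV cardsU1 vS /=.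
apply: leq_trans h _; apply: subset_leq_card; apply/subsetP => q.
rewrite in_nbrI => /andP[evq /commonP[qA qS]]; apply/commonP; split=> //.
by move=> w; rewrite in_setU1 => /orP[/eqP->//|/qS].
Qed.

(** Landing on [w] alone would not pay for the roots in [D]. Since [D] is attached only at [w], the
    root edges into [D] are dropped instead, at the price of lowering [k] by one. The result
    satisfies [k <= n + b u], and an outer vertex [v] has one edge to [w |: D], so
    [b v + 1 <= j + 1 < k] is enough for [compose]. *)
Lemma single_bicore w z a :
    let K := [set w] :|: common [set w] in let D := component (V :\: K) z in
    w \in V -> w \notin A -> a \in common [set w] -> z \in V :\: K ->
    {in D, forall v, nbr v :&: common [set w] = set0} ->
    (exists2 v, v \in D & e v w) ->
  ends V A b k.
Proof.
move=> K D wV wA aQ zVK noQ [f fD efw].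
have DV : D \subset V := comp_V zVK.
have dKD : [disjoint K & D] := comp_disj zVK.
have D0 : D != set0 by apply/set0Pn; exists f.
have wK : w \in K by rewrite in_setU in_set1 eqxx.
have aA := subsetP (common_sub _) a aQ.
have wD : w \notin D by rewrite (disjointFr dKD wK).
have aD : a \notin D by rewrite (disjointFr dKD) // in_setU aQ orbT.
have aw : a != w by apply: contraNneq wA => <-.
have inD v y : v \in D -> y \in V -> e v y -> y \in w |: D.
  move=> vD yV evy; have := comp_in zVK vD yV evy.
  rewrite !in_setU -/D => /orP[/orP[->//|yQ]|->]; last by rewrite orbT.
  have : y \in nbr v :&: common [set w] by rewrite in_nbrI evy.
  by rewrite noQ // in_set0.
have [||u [n [uD bu n0 kn Pn]]] := IH (V := D) (A := nbr w) (b := b) (k := k.-1).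
- by apply: comp_lt => //; apply/set0Pn; exists w; rewrite in_setI wK.
- split=> // [v vD|D2 D2D D20].
    have := deg (subsetP DV _ vD).
    suff : #|nbr v :&: V| <= e w v + #|nbr v :&: D|.
      by rewrite in_nbr; case: (v \in A); move: j_lt; clear; lia.
    rewrite e_sym -card_nbr1 //; apply: subset_leq_card; apply/subsetP => y.
    by rewrite !in_nbrI => /andP[evy yV]; rewrite evy; apply: inD evy.
  have [|nob] := boolP [exists v in D2, 0 < b v].
    move=> _; have [n0|n0] := eqVneq (nb D D2) set0; last first.
      by move: n0; rewrite -card_gt0; clear; lia.
    have -> : D2 = D by apply: comp_conn n0.
    suff -> : nbr w :&: D != set0 by clear; lia.
    by apply/set0Pn; exists f; rewrite in_nbrI e_sym efw.
  have b2 : {in D2, forall v, b v = 0}.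
    move=> v vD; apply/eqP; rewrite -leqn0 leqNgt; apply: contra nob => bv.
    by apply/existsP; exists v; rewrite vD.
  apply: leq_trans (cut (subset_trans D2D DV) D20 b2) _; rewrite addn0.
  have [ewD|ewD] := eqVneq (nbr w :&: D2) set0.
    rewrite addn0; apply: subset_leq_card; apply/subsetP => y /nbP[yV yD [v vD evy]].
    apply/nbP; split=> //; last by exists v.
    have := inD v y (subsetP D2D _ vD) yV evy; rewrite in_setU1 => /orP[/eqP yw|//].
    have : v \in nbr w :&: D2 by rewrite in_nbrI e_sym -yw evy.
    by rewrite ewD in_set0.
  apply: (@leq_trans #|w |: nb D D2|).
    apply: subset_leq_card; apply/subsetP => y /nbP[yV yD [v vD evy]].
    have := inD v y (subsetP D2D _ vD) yV evy; rewrite !in_setU1 => /orP[->//|yD'].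
    by apply/orP; right; apply/nbP; split=> //; exists v.
  by rewrite cardsU1 addnC leq_add2l; case: (w \notin _).
have wDV : w |: D \subset V by rewrite subUset sub1set wV.
apply: (@compose N V (w |: D) A a) => //.
- by apply/set0Pn; exists w; rewrite setU11.
- by rewrite in_setD in_setU1 negb_or aw aD (subsetP AV).
move=> v; rewrite in_setD in_setU1 negb_or => /andP[/andP[vw vD] vV] /set0Pn[y].
rewrite in_nbrI in_setU1 => /andP[evy /orP[/eqP yw|yD]]; last first.
  have := inD y v yD vV; rewrite e_sym evy in_setU1 (negbTE vw) (negbTE vD).
  by move=> /(_ isT).
exists u, n; split=> //; first by rewrite in_setU1 uD orbT.
  have : #|nbr v :&: (w |: D)| <= 1.
    rewrite -(cards1 w); apply: subset_leq_card; apply/subsetP => x.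
    rewrite in_nbrI in_setU1 in_set1 => /andP[evx /orP[//|xD]].
    have := inD x v xD vV; rewrite e_sym evx in_setU1 (negbTE vw) (negbTE vD).
    by move=> /(_ isT).
  by have := b_max vV; move: kn j_lt; clear; lia.
apply: (ap_add (c := 1)) Pn => i [x]; rewrite in_nbr => ewx px.
by exists w; [rewrite -yw | rewrite addn1; apply: spath_cons px ewx wD].
Qed.

Lemma independent_roots : ends V A b k.
Proof.
(* Among the largest bicores, one that leaves positive weight outside is
   preferred. If none does, then no bicore of the same size misses w below. *)
pose bad S := [exists y in V :\: (S :|: common S), 0 < b y].
have P0 : bicore set0.
  rewrite /bicore sub0set cards0; apply/card_gt0P.
  have /card_gt0P[a aA] := ltnW A_gt1; exists a; apply/commonP; split=> // w.
  by rewrite inE.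
(* The factor 2 makes the size decide before the Boolean. *)
have [S PS Smax] : exists2 S, bicore S & forall S', bicore S' ->
    2 * #|S'| + bad S' <= 2 * #|S| + bad S.
  by case: (@arg_maxnP _ _ bicore (fun S => 2 * #|S| + bad S) P0) => S PS Sm; exists S.
set Q := common S; set K := S :|: Q.
have /andP[SV SQ] := PS; rewrite -/Q in SQ.
have QA : Q \subset A := common_sub S.
have dSQ : [disjoint S & Q] := bicore_disj PS.
have bSQ : biclique S Q := @common_biclique S.
have KV : K \subset V by rewrite subUset SV (subset_trans QA).
have Q0 : Q != set0 by rewrite -card_gt0; apply: leq_ltn_trans SQ.
have K0 : K :&: V != set0.
  by rewrite (setIidPl KV); apply: contraNneq Q0 => KE; rewrite -subset0 -KE subsetUr.
have outA v : v \notin K -> v \in A -> nbr v :&: Q = set0 /\ #|nbr v :&: S| < #|S|.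
  by rewrite in_setU negb_or => /andP[_]; apply: out_root.
have out2 v : v \in V -> v \notin K -> 1 < #|nbr v :&: Q| ->
    nbr v :&: S = set0 /\ #|nbr v :&: Q| <= #|S|.+1.
  rewrite in_setU negb_or => vV /andP[vS vQ] h; split; first exact: out_two h.
  rewrite leqNgt; apply/negP => /(bicore_add PS vV vS)/Smax.
  by rewrite cardsU1 vS; case: (bad _); case: (bad _); clear; lia.
have cardS v : #|nbr v :&: S| <= #|S| by apply: subset_leq_card; apply: subsetIr.
have [bS|noY] := boolP (bad S).
  move: (bS) => /existsP[z /andP[zVK bz]]; rewrite -/Q -/K in zVK.
  set D := component (V :\: K) z.
  have DP v : v \in D -> v \in V /\ v \notin K.
    by move/(subsetP (comp_sub zVK)); rewrite in_setD => /andP[].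
  have [|noQ] := boolP [exists v in D, nbr v :&: Q != set0].
    move=> /existsP[f /andP[fD fQ]].
    apply: (@land_core K Q z #|S|.+1) => //.
    - exact: subsetUr.
    - by exists f.
    - exact: bic_vals.
    - by move=> v /DP[vV vK]; apply: bic_loss => //; [apply: outA | apply: out2].
    by move=> v /DP[vV vK]; apply: bic_tails => // /(outA v vK)[].
  have vQ v : v \in D -> nbr v :&: Q = set0.
    move=> vD; apply/eqP/negPn; apply: contra noQ => h.
    by apply/existsP; exists v; rewrite vD.
  have nK v : v \in D -> nbr v :&: K = nbr v :&: S.
    by move=> vD; rewrite /K setIUr vQ // setU0.
  have [f fD] := comp_nbr zVK K0; rewrite nK // => fS.
  (* The component sees only [S], which is reached with the [#|S|] odd lengths. A root in [D] that
     sees nothing of [S] still loses 1, so [#|S|] must exceed 1. *)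
  have [S1|S1] := ltnP 1 #|S|.
    apply: (@land_core K S z #|S|) => //.
    - exact: subsetUl.
    - by exists f.
    - exact: ltnW.
    - exists 1, 2; split; first by right.
      move=> i iS l lS; have [q qQ pq] := biclique_odd bSQ dSQ lS iS (ltn_trans iS SQ).
      by exists q; rewrite ?add1n //; apply: (subsetP QA).
    - move=> v vD; have [vV vK] := DP v vD; rewrite nK // -card_gt0.
      case vA: (v \in A).
        by have [_] := outA v vK vA; move: S1; clear; lia.
      by have := cardS v; move: S1; clear; lia.
    move=> v vD h; rewrite nK // h cards0; case vA: (v \in A); last exact: (@ap_range _ 0).
    by apply: (ap1 (a := 0)); left.
  have /cards1P[w SE] : #|S| == 1.
    have /set0Pn[w] := fS; rewrite in_nbrI => /andP[_ wS].
    by rewrite eqn_leq S1; apply/card_gt0P; exists w.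
  have wS : w \in S by rewrite SE inE.
  have /set0Pn[a aQ] := Q0.
  apply: (@single_bicore w z a); rewrite -?SE -/Q -/K -/D //.
  - exact: (subsetP SV).
  - exact: bicore_notin wS.
  have /set0Pn[y] := fS; rewrite in_nbrI SE in_set1 => /andP[efy /eqP yw].
  by exists f; rewrite -?yw.
have b0 v : v \in V -> v \notin K -> b v = 0.
  move=> vV vK; apply/eqP; rewrite -leqn0 leqNgt; apply: contra noY => bv.
  by apply/existsP; exists v; rewrite in_setD vK vV.
have inK v : v \in V -> b v = j -> v \in K.
  by move=> vV bv; apply: contraLR j_gt0 => /(b0 _ vV); rewrite -bv => ->.
(* Neither [S] nor [Q] contains an edge, so two adjacent vertices of weight [j] lie on different
   sides. *)
have [w [u [wS bw uQ bu]]] : exists w u, [/\ w \in S, b w = j, u \in Q & b u = j].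
  have [u uV bu] := B_ex; have [w [wV euw bw]] := B_nbr uV bu.
  have := inK u uV bu; have := inK w wV bw; rewrite !in_setU.
  move=> /orP[wS|wQ] /orP[uS|uQ]; try by [exists w, u | exists u, w].
    by rewrite (bicore_ind PS) in euw.
  by rewrite Aind ?(subsetP QA) in euw.
have wV := subsetP SV w wS; have uA := subsetP QA u uQ; have uV := subsetP AV u uA.
have [kS|Sk] := ltnP k (#|S|.+1 + j).
  exists u, #|S|.+1; split=> //; rewrite ?bu //.
  by apply: ap_imp (bic_vals bSQ dSQ QA SQ) => i /(_ u uQ); apply: rpath_sub.
have wA : w \notin A by apply: bicore_notin wS.
(* If [w] has a neighbour outside [K], it leaves [S] and becomes the target; the smaller set [S1]
   keeps all the common neighbours of [S]. *)
have [|noX] := boolP [exists x in V :\: K, e w x].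
  move=> /existsP[x]; rewrite in_setD => /andP[/andP[xK xV] ewx].
  set S1 := S :\ w; set Q1 := common S1.
  have S1S : S1 \subset S by apply: subD1set.
  have S1E : #|S| = #|S1|.+1 by rewrite (cardsD1 w) wS.
  have QQ1 : Q \subset Q1.
    by apply/subsetP => q /commonP[qA qS]; apply/commonP; split=> // y /(subsetP S1S)/qS.
  have S1Q1 : #|S1| < #|Q1|.
    by apply: leq_trans (subset_leq_card QQ1); rewrite -S1E; apply: ltnW.
  have P1 : bicore S1 by rewrite /bicore S1Q1 (subset_trans S1S).
  have dSQ1 := bicore_disj P1; have Q1A : Q1 \subset A := common_sub _.
  have bSQ1 := @common_biclique S1.
  have KS : K \subset w |: (S1 :|: Q1) by rewrite setUA setD1K // setUS.
  have out v : v \in V :\: (w |: (S1 :|: Q1)) ->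
      [/\ v \in V, v \notin S1, v \notin Q1, v != w & v \notin K].
    rewrite in_setD => /andP[vn ->]; split=> //; last by apply: contra vn; apply: (subsetP KS).
    - by apply: contra vn => vS; rewrite !in_setU vS orbT.
    - by apply: contra vn => vS; rewrite !in_setU vS !orbT.
    - by apply: contra vn => /eqP->; apply: setU11.
  apply: (@retarget_core (S1 :|: Q1) Q1 w x #|S1|.+1) => //.
  - by rewrite subUset (subset_trans S1S) // (subset_trans Q1A).
  - exact: subsetUr.
  - rewrite in_setU in_setD1 eqxx /=; apply: contra wA; exact: (subsetP Q1A).
  - by rewrite bw.
  - rewrite in_setD xV andbT setUA setD1K // in_setU negb_or.
    move: xK; rewrite in_setU negb_or => /andP[-> xQ]; apply: contra xQ.
    move=> /commonP[xA xS]; apply/commonP; split=> // y yS.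
    by have [->//|yw] := eqVneq y w; apply: xS; rewrite in_setD1 yw.
  - by move=> v /out[vV _ _ _ vK]; apply: b0.
  - exact: bic_vals.
  - move=> v /out[vV vS vQ vw vK]; apply: bic_loss => //; first exact: out_root.
    move=> h; split; first exact: out_two h.
    (* Otherwise [v |: S1] would be a bicore of the same size as [S] that leaves the weight of [w]
       outside, against the choice of [S]. *)
    rewrite leqNgt; apply/negP => /(bicore_add P1 vV vS) P2.
    have := Smax _ P2; rewrite (negbTE noY) cardsU1 vS S1E.
    suff -> : bad (v |: S1) by clear; lia.
    apply/existsP; exists w; rewrite bw j_gt0 andbT in_setD wV andbT.
    rewrite !in_setU in_set1 in_setD1 eqxx eq_sym (negbTE vw) /=.
    by apply: contra wA; apply: (subsetP (common_sub _)).
  move=> v /out[vV vS vQ vw vK]; apply: bic_tails => // vA.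
  by have [] := out_root vQ vA.
(* Now all neighbours of [w] lie in [Q], and the degree of [w] makes [Q] so large that [u] can be
   removed from it and become the target. *)
have wQ : k - j < #|Q|.
  have := deg wV; rewrite (negbTE wA) bw.
  suff : #|nbr w :&: V| <= #|Q| by move: j_lt; clear; lia.
  apply: subset_leq_card; apply/subsetP => x; rewrite in_nbrI => /andP[ewx xV].
  have : x \in K by apply: contraNT noX => xK; apply/existsP; exists x; rewrite in_setD xK xV.
  by rewrite in_setU => /orP[xS|//]; rewrite (bicore_ind PS) in ewx.
have [x xVK eux] : exists2 x, x \in V :\: K & e u x.
  have [|noU] := boolP [exists x in V :\: K, e u x].
    by move=> /existsP[x /andP[xVK eux]]; exists x.
  have := deg uV; rewrite uA bu.
  suff : #|nbr u :&: V| <= #|S| by move: Sk j_lt; clear; lia.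
  apply: subset_leq_card; apply/subsetP => x; rewrite in_nbrI => /andP[eux xV].
  have : x \in K by apply: contraNT noU => xK; apply/existsP; exists x; rewrite in_setD xK xV.
  by rewrite in_setU => /orP[//|xQ]; rewrite Aind ?(subsetP QA) in eux.
have QuQ : Q :\ u \subset Q by apply: subD1set.
have uKE : u |: (S :|: Q :\ u) = K by rewrite setUCA setD1K.
have bSu : biclique S (Q :\ u) by move=> y q yS /(subsetP QuQ); apply: bSQ.
have dSu : [disjoint S & Q :\ u] by apply: disjointWr QuQ dSQ.
have QuA : Q :\ u \subset A by apply: subset_trans QA.
have SQu : #|S| < #|Q :\ u|.
  by have := cardsD1 u Q; rewrite uQ; move: Sk wQ j_lt; clear; lia.
have nQu v : nbr v :&: (Q :\ u) \subset nbr v :&: Q by apply: setIS.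
have outA' v : v \notin K -> v \in A -> nbr v :&: (Q :\ u) = set0 /\ #|nbr v :&: S| < #|S|.
  move=> vK vA; have [vQ vS] := outA v vK vA; split=> //.
  by apply/eqP; rewrite -subset0 -vQ.
apply: (@retarget_core (S :|: Q :\ u) (Q :\ u) u x #|S|.+1); rewrite ?uKE //.
- by apply: subset_trans KV; rewrite -uKE; apply: subsetUr.
- exact: subsetUr.
- by rewrite in_setU in_setD1 eqxx (disjointFl dSQ uQ).
- by rewrite bu.
- by move=> v; rewrite in_setD => /andP[vK vV]; apply: b0.
- exact: bic_vals.
- move=> v; rewrite in_setD => /andP[vK vV]; apply: bic_loss => //; first exact: outA'.
  move=> h; have h' := leq_trans h (subset_leq_card (nQu v)).
  have [-> h2] := out2 v vV vK h'; split=> //.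
  exact: leq_trans (subset_leq_card (nQu v)) h2.
move=> v; rewrite in_setD => /andP[vK vV]; apply: bic_tails => // vA.
by have [] := outA' v vK vA.
Qed.

End Independent.

End Core.

(** * From rooted paths to cycles *)

Lemma core_ends N (V A : {set T}) b k j :
  solved N -> #|V| <= N -> core V A b k j -> ends V A b k.
Proof.
move=> IH VN coreV.
have [|noA] := boolP [exists x in A, exists y in A, e x y].
  move=> /existsP[x /andP[xA /existsP[y /andP[yA exy]]]].
  exact: (adjacent_roots IH VN coreV xA yA exy).
have Aind : {in A &, forall u v, e u v = false}.
  move=> u v uA vA; apply: contraNF noA => euv.
  by apply/existsP; exists u; rewrite uA; apply/existsP; exists v; rewrite vA.
pose M q1 q2 := nbr q1 :&: nbr q2 :&: V.
have [|noM] := boolP [exists q1 in A, exists q2 in A, (q1 != q2) &&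
    [exists x in M q1 q2, exists y in M q1 q2, e x y]].
  move=> /existsP[q1 /andP[q1A /existsP[q2 /and3P[q2A q12]]]].
  move=> /existsP[x /andP[xM /existsP[y /andP[yM exy]]]].
  exact: (adjacent_common IH VN coreV Aind q1A q2A q12 xM yM exy).
apply: (independent_roots IH VN coreV Aind) => q1 q2 q1A q2A q12 x y xM yM.
apply: contraNF noM => exy.
apply/existsP; exists q1; rewrite q1A; apply/existsP; exists q2; rewrite q2A q12.
by apply/existsP; exists x; rewrite xM; apply/existsP; exists y; rewrite yM.
Qed.

Lemma all_solved N : solved N.
Proof.
elim: N => [//|N IH]; apply: solved_step => // V A b k j; exact: core_ends.
Qed.

Lemma min_degree_le v : min_degree e <= degree e v.
Proof.
rewrite /min_degree; have := mem_index_enum v.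
elim: (index_enum T) => // x s IHs; rewrite big_cons inE => /orP[/eqP->|/IHs h].
  exact: geq_minl.
exact: leq_trans (geq_minr _ _) h.
Qed.

(** A boundary of at most one vertex misses [x] or [y], and its deletion would separate [D] from
    that vertex. *)
Lemma two_connected_nb (D : {set T}) x y : k_connected e 2 -> D != set0 ->
  x \notin D -> y \notin D -> x != y -> 1 < #|nb setT D|.
Proof.
move=> [_ conn2] /set0Pn[d dD] xD yD xy; rewrite ltnNge; apply/negP => n1.
have [q qD qn] : exists2 q, q \notin D & q \notin nb setT D.
  have [xn|] := boolP (x \in nb setT D); last by exists x.
  exists y => //; apply: contra xy => yn.
  by move/card_le1P: n1 => /(_ x xn y); rewrite yn inE eq_sym.
have dn : d \in ~: nb setT D.
  by rewrite in_setC; apply/nbP => -[_ /negP[]].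
have qn' : q \in ~: nb setT D by rewrite in_setC.
have /connectP[p] := conn2 _ n1 d q dn qn'.
elim: p d dD {dn} => [|z p IHp] d dD /=; first by move=> _ qd; rewrite qd dD in qD.
move=> /andP[/andP[/andP[_ zn] edz] pz]; apply: (IHp z) => //.
rewrite in_setC in zn; apply: contraNT zn => zD; apply/nbP; split=> //.
by exists d.
Qed.

Lemma nth_choice (C : Type) (c0 : C) (P : nat -> C -> Prop) n :
  (forall i, i < n -> exists c, P i c) ->
  exists2 s, size s = n & forall i, i < n -> P i (nth c0 s i).
Proof.
elim: n => [|n IHn] h; first by exists [::].
have [|s sn sP] := IHn; first by move=> i ilt; apply: h; apply: ltnW.
have [c cP] := h n (ltnSn n); exists (rcons s c); first by rewrite size_rcons sn.
move=> i; rewrite ltnS leq_eqVlt nth_rcons sn => /orP[/eqP->|ilt].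
  by rewrite ltnn eqxx.
by rewrite ilt; apply: sP.
Qed.

(** With [x] as root and [y] as target, the edges from [v] to [x] and [y] reappear as [v \in A] and
    [b v], so degrees are preserved; likewise [x] and [y] count in a boundary exactly through these
    two terms. *)
Lemma edge_adm k x y : k_connected e 2 -> k + 1 <= min_degree e -> e x y ->
  adm (~: [set x; y]) (nbr x) (fun v => nat_of_bool (e y v)) k.
Proof.
move=> conn2 mindeg exy; have [T2 _] := conn2.
have xy : x != y by apply: contraTneq exy => ->; rewrite e_irr.
set V := ~: _.
have inV w : w \notin V -> w = x \/ w = y.
  by rewrite inE negbK !inE => /orP[]/eqP; [left | right].
have xV : x \notin V by rewrite !inE eqxx.
have yV : y \notin V by rewrite !inE eqxx orbT.
split.
- rewrite -card_gt0; have := cardsC [set x; y]; rewrite cards2 xy -/V.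
  by move: T2; clear; lia.
- move=> v vV; have := leq_trans mindeg (min_degree_le v); rewrite in_nbr.
  have -> : degree e v = #|nbr v :&: (x |: (y |: V))|.
    apply: eq_card => w; rewrite in_nbrI [LHS]inE; case evw: (e v w) => //=.
    apply/esym; rewrite !in_setU1; have [_|/inV[]->] := boolP (w \in V);
      by rewrite ?eqxx ?orbT.
  rewrite !card_nbr1 // ?(e_sym x) ?(e_sym y); first by clear; lia.
  by rewrite in_setU1 negb_or xy.
move=> D DV D0.
have xD : x \notin D by apply: contra xV; apply: (subsetP DV).
have yD : y \notin D by apply: contra yV; apply: (subsetP DV).
apply: leq_trans (two_connected_nb conn2 D0 xD yD xy) _.
have adj z (c : bool) : ({in D, forall v, e v z -> c}) ->
    #|nb setT D :&: [set z]| <= c.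
  move=> h; case: c h => [|h].
    by move=> _; apply: leq_trans (subset_leq_card (subsetIr _ _)) _; rewrite cards1.
  rewrite leqn0 cards_eq0 -subset0; apply/subsetP => w; rewrite in_setI in_set1.
  by move=> /andP[/nbP[_ _ [v vD evw]] /eqP wz]; have := h v vD; rewrite -wz evw => /(_ isT).
have S : nb setT D \subset (nb V D :|: nb setT D :&: [set x]) :|: nb setT D :&: [set y].
  apply/subsetP => w wn; rewrite !in_setU !in_setI wn !in_set1 /=.
  have [wV|/inV[]->] := boolP (w \in V); rewrite ?eqxx ?orbT //.
  by have /nbP[_ wD ew] := wn; apply/orP; left; apply/orP; left; apply/nbP.
apply: leq_trans (subset_leq_card S) _.
apply: leq_trans (leq_card_setU _ _) _; apply: leq_add; last first.
  by apply: adj => v vD evy; apply/existsP; exists v; rewrite vD e_sym evy.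
apply: leq_trans (leq_card_setU _ _) _; rewrite leq_add2l; apply: adj => v vD evx.
by apply/set0Pn; exists v; rewrite in_nbrI e_sym evx.
Qed.

End Graph.

Theorem theorem5 (k : nat) (T : finType) (e : rel T)
    (k_gt0 : 0 < k)
    (e_sym : symmetric e) (e_irr : irreflexive e)
    (G_2conn : k_connected e 2)
    (G_oddcycle : exists C : seq T,
       [/\ induced_cycle e C, odd (num_edges C) & non_separating e C])
    (G_mindeg : k + 1 <= min_degree e) :
  exists Hs : seq (seq T),
    [/\ size Hs = k,
        all (is_cycle e) Hs
      & consecutive_lengths Hs \/ length_condition Hs].
Proof.
have [T2 _] := G_2conn.
have /card_gt0P[x _] : 0 < #|T| by apply: leq_ltn_trans T2.
have [y exy] : exists y, e x y.
  have : 0 < degree e x.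
    by apply: leq_trans (min_degree_le e x); apply: leq_trans G_mindeg; rewrite addn1.
  by case/card_gt0P => y; rewrite inE; exists y.
set V := ~: [set x; y].
have [u [n [uV eyu n0 kn Pn]]] :=
  all_solved e_sym e_irr (ltnSn #|V|) (edge_adm e_sym e_irr G_2conn G_mindeg exy).
have {}eyu : e y u by case: (e y u) eyu.
have xy : x != y by apply: contraTneq exy => ->; rewrite e_irr.
have xV : x \notin V by rewrite !inE eqxx.
have yV : y \notin V by rewrite !inE eqxx orbT.
have [|a [d [dP aP]]] := ap_leq (m := k) _ Pn; first by move: kn; rewrite eyu addn1.
(* The edges [yx], [xz] and [uy] close a path from [z] to [u] into a cycle, three longer than the
   path. *)
have [|Hs sH HsP] := @nth_choice (seq T) [::]
    (fun i C => is_cycle e C /\ size C = (a + d * i).+3) k.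
  move=> i /aP[z]; rewrite in_nbr => exz [p [ep lp up pV <-]].
  exists [:: y, x, z & p]; split=> //; apply/and3P; split=> //.
    by rewrite /= rcons_path ep lp e_sym exy exz /= e_sym.
  have xp : x \notin z :: p by apply: contra xV; apply: pV.
  have yp : y \notin z :: p by apply: contra yV; apply: pV.
  by rewrite (cons_uniq y) (cons_uniq x) up xp in_cons negb_or eq_sym xy yp.
exists Hs; split=> //.
  by apply/(all_nthP [::]) => i; rewrite sH => /HsP[].
have step : lengths_step d Hs.
  split; first by rewrite -nth0 /num_edges; have [_ ->] := HsP 0 k_gt0.
  move=> i iH; rewrite sH in iH; rewrite /num_edges.
  have [_ ->] := HsP _ iH; have [_ ->] := HsP _ (ltnW iH).
  by rewrite mulnS; clear; lia.
by case: dP step => ->; [left | right].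
Qed.
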